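(* Let $m\ge 1$, $1\le p<\infty$, let $X$ be any one of the four sets $\widetilde{S}^{m}$, $E^{m}$, $S_0^{m}$, $S^{m}$, and let $U\subset X$. Then $U$ is relatively compact in $(X,d_p)$ if and only if (i) $U$ is uniformly $p$-mean bounded; (ii) $U$ is $p$-mean equi-left-continuous; and (iii$'$) for every sequence $\{u_n: n=1,2,\ldots\}\subset U$ there exist $r>0$ and a subsequence $\{v_n\}$ of $\{u_n\}$ such that $\lim_{n\to\infty}|v_n|^r=0$, where $|\cdot|^r$ is the functional defined in the context (the $r$ is a superscript index, not a power).
   Context: $H$ is the Hausdorff metric on nonempty closed subsets of $\mathbb{R}^m$ (Euclidean distance): $H(A,B)=\max\{\sup_{a\in A}\inf_{b\in B}d(a,b),\ \sup_{b\in B}\inf_{a\in A}d(a,b)\}$. A fuzzy set on $\mathbb{R}^m$ is a function $u:\mathbb{R}^m\to[0,1]$; its cuts are $[u]_\alpha=\{x: u(x)\ge\alpha\}$ for $\alpha\in(0,1]$ and $[u]_0=\overline{\{x: u(x)>0\}}$. $F_B(\mathbb{R}^m)$ is the set of fuzzy sets $u$ on $\mathbb{R}^m$ that are normal ($u(x_0)=1$ for some $x_0$), upper semi-continuous, and have $[u]_0$ bounded. The metric is $d_p(u,v)=\left(\int_0^1 H([u]_\alpha,[v]_\alpha)^p\,d\alpha\right)^{1/p}$. Subsets of $F_B(\mathbb{R}^m)$: - $E^{m}$: those $u$ that are fuzzy convex, i.e. $u(\lambda x+(1-\lambda)y)\ge\min\{u(x),u(y)\}$ for all $x,y\in\mathbb{R}^m$,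 $\lambda\in[0,1]$; - $S_0^{m}$: those $u$ with $u(\lambda y)\ge u(y)$ for all $y\in\mathbb{R}^m$, $\lambda\in[0,1]$; - $S^{m}$: those $u$ for which there is $x\in\mathbb{R}^m$ with $u(\lambda y+(1-\lambda)x)\ge u(y)$ for all $y\in\mathbb{R}^m$, $\lambda\in[0,1]$; - $\widetilde{S}^{m}$: those $u$ such that for every $\alpha\in(0,1]$ there is $x_\alpha\in[u]_\alpha$ such that for all $y\in[u]_\alpha$ the segment $\overline{x_\alpha y}$ is contained in $[u]_\alpha$. A set $U$ of such fuzzy sets is uniformly $p$-mean bounded if there is $M>0$ with $d_p(u,\widehat{0})\le M$ for all $u\in U$, where $\widehat 0$ is the characteristic function of $\{0\}$ ($0$ the origin). $U$ is $p$-mean equi-left-continuous if for every $\varepsilon>0$ there is $\delta>0$ such that for all $0\le h<\delta$ and all $u\in U$, $\left(\int_h^1 H([u]_\alpha,[u]_{\alpha-h})^p\,d\alpha\right)^{1/p}<\varepsilon$. For $r>0$ let $B_r=\{x\in\mathbb{R}^m:\|x\|\le r\}$, let $\widehat{B_r}$ be its characteristic function, and for $u\in F_B(\mathbb{R}^m)$ put $|u|^r:=\left(\int_0^1 H([u\vee\widehat{B_r}]_\alpha,[\widehat{B_r}]_\alpha)^p\,d\alpha\right)^{1/p}$, where $\vee$ is the pointwise maximum. A subset of a metric space $X$ is relatively compact in $X$ if its closure in $X$ is compact. *)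

(* Defs.v *)
From HB Require Import structures.
From mathcomp Require Import all_boot all_order all_algebra.
From mathcomp Require Import all_classical all_reals all_analysis.
Set Implicit Arguments.
Unset Strict Implicit.
Unset Printing Implicit Defensive.
Import Order.TTheory GRing.Theory Num.Theory.
Import numFieldNormedType.Exports.
Local Open Scope classical_set_scope.
Local Open Scope ring_scope.

(* The norm of the library on row vectors is the sup norm, so the Euclidean
   one is defined here.  Both induce the product topology, which is the one
   used for [closure] and for neighbourhoods of points of R^m below. *)
Definition enorm (R : realType) (m : nat) (x : 'rV[R]_m) : R :=
  Num.sqrt (\sum_(i < m) x 0 i ^+ 2).

Definition edist (R : realType) (m : nat) (x y : 'rV[R]_m) : R := enorm (x - y).

Definition ebounded (R : realType) (m : nat) (A : set 'rV[R]_m) : Prop :=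
  exists M : R, forall x, A x -> enorm x <= M.

Definition excess (R : realType) (m : nat) (A B : set 'rV[R]_m) : \bar R :=
  ereal_sup [set ereal_inf [set (edist a b)%:E | b in B] | a in A].

Definition hausdorff (R : realType) (m : nat) (A B : set 'rV[R]_m) : \bar R :=
  maxe (excess A B) (excess B A).

(* Membership grades are real numbers; that they lie in [0, 1] is required by
   [is_fuzzy_set] below. *)
Definition fuzzy (R : realType) (m : nat) : Type := 'rV[R]_m -> R.

Definition is_fuzzy_set (R : realType) (m : nat) (u : fuzzy R m) : Prop :=
  forall x, 0 <= u x <= 1.

Definition cut (R : realType) (m : nat) (u : fuzzy R m) (a : R) : set 'rV[R]_m :=
  if a == 0 then closure [set x | 0 < u x] else [set x | a <= u x].

Definition normal_fuzzy (R : realType) (m : nat) (u : fuzzy R m) : Prop :=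
  exists x0, u x0 = 1.

Definition upper_semicontinuous (R : realType) (m : nat) (u : fuzzy R m) : Prop :=
  forall x (a : R), u x < a -> \forall y \near x, u y < a.

Definition FB (R : realType) (m : nat) : set (fuzzy R m) :=
  [set u | [/\ is_fuzzy_set u, normal_fuzzy u, upper_semicontinuous u &
               ebounded (cut u 0)]].

Definition fuzzy_E (R : realType) (m : nat) : set (fuzzy R m) :=
  [set u | FB u /\ forall (x y : 'rV[R]_m) (l : R), 0 <= l <= 1 ->
             Num.min (u x) (u y) <= u (l *: x + (1 - l) *: y)].

Definition fuzzy_S0 (R : realType) (m : nat) : set (fuzzy R m) :=
  [set u | FB u /\ forall (y : 'rV[R]_m) (l : R), 0 <= l <= 1 ->
             u y <= u (l *: y)].

Definition fuzzy_S (R : realType) (m : nat) : set (fuzzy R m) :=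
  [set u | FB u /\ exists x : 'rV[R]_m, forall (y : 'rV[R]_m) (l : R),
             0 <= l <= 1 -> u y <= u (l *: y + (1 - l) *: x)].

Definition segment (R : realType) (m : nat) (x y : 'rV[R]_m) : set 'rV[R]_m :=
  [set l *: x + (1 - l) *: y | l in [set l : R | 0 <= l <= 1]].

Definition fuzzy_St (R : realType) (m : nat) : set (fuzzy R m) :=
  [set u | FB u /\ forall a : R, 0 < a <= 1 -> exists2 x : 'rV[R]_m,
             cut u a x & forall y, cut u a y -> segment x y `<=` cut u a].

(* Extended-real valued, as are the other integral functionals below; all of
   them are finite on [FB]. *)
Definition dp (R : realType) (m : nat) (p : R) (u v : fuzzy R m) : \bar R :=
  ((\int[lebesgue_measure]_(a in `[0%R, 1%R]) (hausdorff (cut u a) (cut v a) `^ p))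
     `^ p^-1)%E.

Definition eball (R : realType) (m : nat) (r : R) : set 'rV[R]_m :=
  [set x | enorm x <= r].

Definition normp (R : realType) (m : nat) (p r : R) (u : fuzzy R m) : \bar R :=
  dp p (u \max \1_(@eball R m r)) \1_(@eball R m r).

Definition mean_bounded (R : realType) (m : nat) (p : R) (U : set (fuzzy R m)) :
    Prop :=
  exists2 M : R, 0 < M &
    forall u, U u -> (dp p u \1_[set 0%R] <= M%:E)%E.

Definition mean_equi_left_continuous (R : realType) (m : nat) (p : R)
    (U : set (fuzzy R m)) : Prop :=
  forall e : R, 0 < e -> exists2 d : R, 0 < d &
    forall (h : R) (u : fuzzy R m), 0 <= h < d -> U u ->
      ((\int[lebesgue_measure]_(a in `[h, 1%R])
          (hausdorff (cut u a) (cut u (a - h)%R) `^ p)) `^ p^-1 < e%:E)%E.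

(* The space (X, d_p), with the topology of the metric d_p: a set is open iff
   it contains a d_p-ball around each of its points. *)
Definition dp_space (R : realType) (m : nat) (p : R) (X : set (fuzzy R m)) :
  Type := set_type X.

Section dp_topology.
Variables (R : realType) (m : nat) (p : R) (X : set (fuzzy R m)).
Local Notation T := (dp_space p X).

HB.instance Definition _ := gen_eqMixin T.
HB.instance Definition _ := gen_choiceMixin T.

Definition dp_open (A : set T) : Prop :=
  forall x, A x -> exists2 e : R, 0 < e &
    forall y : T, (dp p (val x) (val y) < e%:E)%E -> A y.

Lemma dp_openT : dp_open setT.
Proof. by move=> x _; exists 1. Qed.

Lemma dp_openI : setI_closed dp_open.
Proof.
move=> A B oA oB x [/oA[e e0 eA] /oB[f f0 fB]].
exists (Num.min e f); first by rewrite lt_min e0 f0.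
move=> y; rewrite EFin_min lt_min => /andP[/eA ? /fB ?]; by split.
Qed.

Lemma dp_open_bigU (I : Type) (f : I -> set T) :
  (forall i, dp_open (f i)) -> dp_open (\bigcup_i f i).
Proof.
move=> of_ x [i _ /of_[e e0 ef]].
by exists e => // y /ef fy; exists i.
Qed.

HB.instance Definition _ :=
  isOpenTopological.Build T dp_openT dp_openI dp_open_bigU.

End dp_topology.

(* [U] is a subset of [X], given as a set of fuzzy sets. *)
Definition relatively_compact_in (R : realType) (m : nat) (p : R)
    (X U : set (fuzzy R m)) : Prop :=
  compact (closure [set x : dp_space p X | U (val x)]).

(* Main.v *)
(* The constants in quasi-triangle inequalities being irrelevant, everything
   is phrased with the integral of H^p, for which
   [(a + b)^p <= 2^p (a^p + b^p)] replaces Minkowski's inequality.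

   Necessity: a sequence in a relatively compact set clusters at some u in X;
   each of (i)-(iii') is true for u and passes to the nearby members of the
   sequence.  For (iii') take B_r to contain the support of u.

   Sufficiency: let |u_n|^r -> 0.  Each cut [u_n]_t, t > 0, is eventually
   bounded, so ultrafilter limits and a diagonal extraction give closed sets
   A_t with H([u_n]_t, A_t) -> 0 for every rational t in (0, 1) along one
   subsequence.  The limit u has the cuts [u]_a = \bigcap_(t < a) A_t.  If t
   is the point of the grid of mesh h just below a, then H([u_n]_a, [u]_a) is
   at most
     H([u_n]_t, A_t) + H([u_n]_a, [u_n]_(a - h))
       + liminf_k H([u_k]_a, [u_k]_(a - h)),
   and (ii) together with Fatou's lemma controls the integral over [h, 1]; on
   [0, h] the distance is at most 2 r plus the integrand of |u_n|^r.  Hence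
   sequences in U have limits in X, and compactness of the closure follows as
   in metric spaces. *)

From Pilot Require Import Defs.
From HB Require Import structures.
From mathcomp Require Import all_boot all_order all_algebra.
From mathcomp Require Import all_classical all_reals all_analysis.
From mathcomp Require Import measurable_realfun.
From mathcomp Require Import ring lra.
Import Order.TTheory GRing.Theory Num.Theory.
Import numFieldNormedType.Exports.
(* [edist] also names a distance of the library. *)
Import Pilot.Defs.
Local Open Scope classical_set_scope.
Local Open Scope ring_scope.
Set Implicit Arguments.
Unset Strict Implicit.
Unset Printing Implicit Defensive.

(** * The Euclidean norm *)

Section euclidean.
Context {R : realType} {m : nat}.
Implicit Types x y z : 'rV[R]_m.

(** What (iii') contributes is a fixed ball. A point of a cut at level a belongs to all lower cuts
    too, so lying far outside [B_r] costs a definite amount of |u_n|^r. Hence the cuts are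
    eventually bounded at each positive level, the sets A_t lie in [B_r], and the limit has bounded
    support. The obstacle is uniformity in the level. Diagonal extraction gives convergence at
    countably many levels without a common rate, and [u]_a may be strictly smaller than every A_t
    with t < a. A finite grid restores a common rate. The excess of A_t over [u]_a is then traced
    back to the sequence: a point of A_t is approximated by points of [u_k]_(a - h), the distance
    between [u_k]_a and [u_k]_(a - h) carries these into [u_k]_a, and there they cluster at a point
    of [u]_a. It is enough that this works for infinitely many k, whence the liminf. Levels below h
    have no shifted cut; a crude bound does there because the interval is short. *)

Lemma enorm_ge0 x : 0 <= enorm x.
Proof. exact: sqrtr_ge0. Qed.

Lemma sqr_enorm x : enorm x ^+ 2 = \sum_(i < m) x 0 i ^+ 2.
Proof. by rewrite sqr_sqrtr // sumr_ge0 // => i _; exact: sqr_ge0. Qed.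

Lemma mx_norm_le_enorm x : `|x| <= enorm x.
Proof.
rewrite [leLHS]mx_normrE; apply/bigmax_leP; split => [|[i j] _ /=].
  exact: enorm_ge0.
rewrite ord1 -sqrtr_sqr ler_sqrt ?sumr_ge0// => [|k _]; last exact: sqr_ge0.
by rewrite (bigD1 j)//= lerDl sumr_ge0// => k _; exact: sqr_ge0.
Qed.

Lemma enorm_eq0 x : enorm x = 0 -> x = 0.
Proof. by move=> x0; apply/eqP; rewrite -normr_le0 -x0 mx_norm_le_enorm. Qed.

(** The squared length of [enorm y *: x - enorm x *: y] is 2 |x| |y| (|x| |y| - <x, y>). The case
    |x| |y| = 0 is split off because this factor is cancelled. *)
Lemma cauchy_schwarz x y :
  \sum_(i < m) x 0 i * y 0 i <= enorm x * enorm y.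
Proof.
have [/eqP|xy0] := eqVneq (enorm x * enorm y) 0.
  rewrite mulf_eq0 => /orP[] /eqP /[dup] z0 /enorm_eq0 ->;
  by rewrite big1 ?z0 ?enorm_ge0 ?mulr_ge0 ?enorm_ge0// => i _; rewrite mxE; ring.
have : 0 <= \sum_(i < m) (enorm y * x 0 i - enorm x * y 0 i) ^+ 2.
  by apply: sumr_ge0 => i _; exact: sqr_ge0.
have -> : \sum_(i < m) (enorm y * x 0 i - enorm x * y 0 i) ^+ 2 =
    2 * (enorm x * enorm y) * (enorm x * enorm y - \sum_(i < m) x 0 i * y 0 i).
  transitivity (enorm y ^+ 2 * (\sum_(i < m) x 0 i ^+ 2) +
      enorm x ^+ 2 * (\sum_(i < m) y 0 i ^+ 2) -
      2 * (enorm x * enorm y) * (\sum_(i < m) x 0 i * y 0 i)).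
    rewrite !mulr_sumr -sumrN -!big_split /=.
    by apply: eq_bigr => i _; ring.
  by rewrite -!sqr_enorm; ring.
rewrite pmulr_rge0 ?subr_ge0// mulr_gt0// lt_def xy0 mulr_ge0//; exact: enorm_ge0.
Qed.

Lemma enormD x y : enorm (x + y) <= enorm x + enorm y.
Proof.
rewrite -[leRHS]ger0_norm ?addr_ge0 ?enorm_ge0// -sqrtr_sqr ler_sqrt ?sqr_ge0//.
rewrite sqrrD !sqr_enorm.
under eq_bigr do rewrite mxE sqrrD.
rewrite !big_split /= lerD2r lerD2l -mulr2n.
by rewrite ler_wMn2r// cauchy_schwarz.
Qed.

Lemma enorm0 : enorm (0 : 'rV[R]_m) = 0.
Proof. by rewrite /enorm big1 ?sqrtr0// => i _; rewrite mxE expr0n. Qed.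

Lemma enormZ (a : R) x : enorm (a *: x) = `|a| * enorm x.
Proof.
rewrite /enorm -sqrtr_sqr -sqrtrM ?sqr_ge0// mulr_sumr.
by congr Num.sqrt; apply: eq_bigr => i _; rewrite mxE exprMn.
Qed.

Lemma enormN x : enorm (- x) = enorm x.
Proof. by rewrite -scaleN1r enormZ normrN1 mul1r. Qed.

Lemma edist_ge0 x y : 0 <= edist x y.
Proof. exact: enorm_ge0. Qed.

Lemma edistC x y : edist x y = edist y x.
Proof. by rewrite /edist -enormN opprB. Qed.

Lemma edistxx x : edist x x = 0.
Proof. by rewrite /edist subrr enorm0. Qed.

Lemma edist_triangle y x z : edist x z <= edist x y + edist y z.
Proof. by rewrite /edist -(subrKA y x (- z)) enormD. Qed.

Lemma edistx0 x : edist x 0 = enorm x.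
Proof. by rewrite /edist subr0. Qed.

Lemma enorm_triangle y x : enorm x <= edist x y + enorm y.
Proof. by rewrite -[in leLHS](subrK y x) enormD. Qed.

Lemma edist_convex (l : R) x y x' y' : 0 <= l <= 1 ->
  edist (l *: x + (1 - l) *: y) (l *: x' + (1 - l) *: y') <=
    l * edist x x' + (1 - l) * edist y y'.
Proof.
move=> /andP[l0 l1]; rewrite /edist opprD addrACA -!scalerBr.
apply: le_trans (enormD _ _) _; rewrite !enormZ !ger0_norm//.
by rewrite subr_ge0.
Qed.

Lemma enorm_le_mx_norm x : enorm x <= Num.sqrt m%:R * `|x|.
Proof.
rewrite -[`|x|]ger0_norm// -sqrtr_sqr -sqrtrM ?ler0n// ler_sqrt; last first.
  by rewrite mulr_ge0 ?ler0n ?sqr_ge0.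
have -> : m%:R * `|x| ^+ 2 = \sum_(i < m) `|x| ^+ 2.
  by rewrite sumr_const card_ord mulr_natl.
rewrite ler_sum// => i _.
rewrite -[x 0 i ^+ 2]real_normK ?num_real// ler_pXn2r ?nnegrE//.
rewrite [leRHS]mx_normrE.
exact: (le_bigmax _ (fun ij : 'I_1 * 'I_m => `|x ij.1 ij.2|) (0, i)).
Qed.

Lemma near_edist x (e : R) : 0 < e -> \forall y \near x, edist y x < e.
Proof.
(* The summand 1 keeps the Lipschitz constant positive, hence invertible, also for [m = 0]. *)
move=> e0; have c0 : 0 < Num.sqrt m%:R + 1 :> R by rewrite ltr_wpDl ?sqrtr_ge0.
near=> y; apply: (le_lt_trans (enorm_le_mx_norm _)).
apply: (@le_lt_trans _ _ ((Num.sqrt m%:R + 1) * `|y - x|)).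
  by rewrite ler_wpM2r// lerDl.
rewrite mulrC -ltr_pdivlMr//.
near: y; apply: (@cvgr_distC_lt _ _ _ (nbhs x)); first exact: cvg_id.
by rewrite divr_gt0.
Unshelve. all: by end_near. Qed.

Lemma near_sub_edist x (A : set 'rV[R]_m) :
  nbhs x A -> exists2 e : R, 0 < e & forall y, edist y x < e -> A y.
Proof.
move=> /nbhs_ballP[e /= e0 eA]; exists e => // y yx; apply: eA.
rewrite -ball_normE /ball_/= distrC.
by rewrite (le_lt_trans (mx_norm_le_enorm _)).
Qed.

Lemma closed_edist (A : set 'rV[R]_m) :
  (forall x, (forall e : R, 0 < e -> exists2 y, A y & edist y x < e) -> A x) ->
  closed A.
Proof.
move=> cA x xA; apply: cA => e e0.
by have [y []] := xA _ (near_edist x e0); exists y.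
Qed.

Lemma closed_edistP (A : set 'rV[R]_m) x : closed A ->
  (forall e : R, 0 < e -> exists2 y, A y & edist y x < e) -> A x.
Proof.
move=> cA xA; apply: cA => B /near_sub_edist[e e0 eB].
by have [y Ay yx] := xA _ e0; exists y; split=> //; exact: eB.
Qed.

Lemma closed_eball (K : R) : closed (@eball R m K).
Proof.
apply: closed_edist => x xK; rewrite /eball/=.
apply/ler_addgt0Pr => e e0; have [y yK yx] := xK _ e0.
by rewrite addrC (le_trans (enorm_triangle y _))// lerD// edistC ltW.
Qed.

Lemma compact_eball (K : R) : compact (@eball R m K).
Proof.
apply: bounded_closed_compact; last exact: closed_eball.
exists K; split; first exact: num_real.
move=> M KM x xK; apply: (le_trans (mx_norm_le_enorm x)).
exact: le_trans xK (ltW KM).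
Qed.

End euclidean.

(** * Excess and Hausdorff distance *)

Section excess.
Context {R : realType} {m : nat}.
Implicit Types A B C : set 'rV[R]_m.
Local Open Scope ereal_scope.

Lemma excess_le A B (r : R) :
  (forall a, A a -> exists2 b, B b & (edist a b <= r)%R) -> excess A B <= r%:E.
Proof.
move=> AB; apply: ge_ereal_sup => _ [a /AB[b Bb ab] <-].
by apply: ge_ereal_inf; exists (edist a b)%:E; [exists b|rewrite lee_fin].
Qed.

Lemma excess_lt A B (r : R) a :
  excess A B < r%:E -> A a -> exists2 b, B b & (edist a b < r)%R.
Proof.
move=> AB Aa.
have /ereal_inf_lt[_ [b Bb <-] ab] :
    ereal_inf [set (edist a b)%:E | b in B] < r%:E.
  by apply: le_lt_trans AB; apply: ereal_sup_ubound; exists a.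
by exists b; rewrite -?lte_fin.
Qed.

Lemma excess_ge A B (r : R) a :
  A a -> (forall b, B b -> r <= edist a b)%R -> r%:E <= excess A B.
Proof.
move=> Aa aB; apply: (@le_trans _ _ (ereal_inf [set (edist a b)%:E | b in B])).
  by rewrite leNgt; apply/negP => /ereal_inf_lt[_ [b /aB + <-]];
     rewrite lte_fin leNgt => /negP.
by apply: ereal_sup_ubound; exists a.
Qed.

(** The strict inequality survives as a margin [s] uniform in [b]: it is the infimum of the
    distances, unless that is [+oo]; then [B] is empty and any [s] above [r] serves. *)
Lemma excess_gt A B (r : R) : r%:E < excess A B ->
  exists2 a, A a & exists2 s : R, (r < s)%R & forall b, B b -> (s <= edist a b)%R.
Proof.
move=> /ereal_sup_gt[_ [a Aa <-]] raB; exists a => //.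
have infB b : B b -> ereal_inf [set (edist a b)%:E | b in B] <= (edist a b)%:E.
  by move=> Bb; apply: ereal_inf_lbound; exists b.
case: ereal_inf raB infB => [s|_|].
- by rewrite lte_fin => rs infB; exists s => // b /infB; rewrite lee_fin.
- by move=> infB; exists (r + 1)%R; [rewrite ltrDl|move=> b /infB].
- by rewrite ltNge leNye.
Qed.

Lemma excess_ge0 A B : A !=set0 -> 0 <= excess A B.
Proof. by move=> [a Aa]; apply: (@excess_ge A B 0%R a Aa) => b _; exact: enorm_ge0. Qed.

Lemma hausdorff_ge0 A B : A !=set0 -> 0 <= hausdorff A B.
Proof. by move=> A0; rewrite le_max excess_ge0. Qed.

Lemma hausdorffC A B : hausdorff A B = hausdorff B A.
Proof. by rewrite /hausdorff maxC. Qed.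

Lemma excess_le_hausdorff A B : excess A B <= hausdorff A B.
Proof. by rewrite le_max lexx. Qed.

Lemma excess_subl A A' B : A `<=` A' -> excess A B <= excess A' B.
Proof. by move=> AA'; apply: ereal_sup_le => _ [a /AA' Aa <-]; exists a. Qed.

Lemma excess_subr A B B' : B `<=` B' -> excess A B' <= excess A B.
Proof.
move=> BB'; apply: ge_ereal_sup => _ [a Aa <-].
apply: (@le_trans _ _ (ereal_inf [set (edist a b)%:E | b in B])).
  by apply: ereal_inf_le_tmp => _ [b /BB' Bb <-]; exists b.
by apply: ereal_sup_ubound; exists a.
Qed.

Lemma excess_subset A B : A `<=` B -> excess A B <= 0.
Proof. by move=> AB; apply: excess_le => a /AB; exists a; rewrite ?edistxx. Qed.

Lemma hausdorff_le A B (r : R) :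
  (forall a, A a -> exists2 b, B b & (edist a b <= r)%R) ->
  (forall b, B b -> exists2 a, A a & (edist b a <= r)%R) ->
  hausdorff A B <= r%:E.
Proof. by move=> AB BA; rewrite ge_max !excess_le. Qed.

Lemma hausdorff_lt A B (r : R) a :
  hausdorff A B < r%:E -> A a -> exists2 b, B b & (edist a b < r)%R.
Proof.
by move=> AB; apply: excess_lt; exact: le_lt_trans (excess_le_hausdorff _ _) AB.
Qed.

(** Nonemptiness keeps [-oo], the excess of an empty set, out of the sum, where it would absorb
    [+oo]. *)
Lemma excess_triangle B A C : A !=set0 -> B !=set0 ->
  excess A C <= excess A B + excess B C.
Proof.
move=> A0 B0; have AB0 := excess_ge0 B A0; have BC0 := excess_ge0 C B0.
case: (excess A B) (@excess_lt A B) AB0 => [r AB _|_ _|//]; last first.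
  by rewrite addye ?leey// gt_eqF// (lt_le_trans _ BC0)// ltNyr.
case: (excess B C) (@excess_lt B C) BC0 => [s BC _|_ _|//]; last first.
  by rewrite addey ?leey.
apply/lee_addgt0Pr => e e0; rewrite -!EFinD; apply: excess_le => a Aa.
have [|b Bb ab] := AB (r + e / 2)%R a _ Aa; first by rewrite lte_fin ltrDl divr_gt0.
have [|c Cc bc] := BC (s + e / 2)%R b _ Bb; first by rewrite lte_fin ltrDl divr_gt0.
exists c => //; apply: (le_trans (edist_triangle b _ _)).
rewrite [e](splitr e); lra.
Qed.

Lemma hausdorff_triangle B A C : A !=set0 -> B !=set0 -> C !=set0 ->
  hausdorff A C <= hausdorff A B + hausdorff B C.
Proof.
move=> A0 B0 C0; rewrite ge_max; apply/andP; split.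
  by apply: (le_trans (excess_triangle C A0 B0)); rewrite leeD ?excess_le_hausdorff.
apply: (le_trans (excess_triangle A C0 B0)); rewrite addeC.
by rewrite leeD// [leRHS]hausdorffC excess_le_hausdorff.
Qed.

Lemma hausdorffxx A : A !=set0 -> hausdorff A A = 0.
Proof.
move=> A0; apply/le_anti/andP; split; last exact: hausdorff_ge0.
by rewrite ge_max excess_subset.
Qed.

(** For nested sets only the excess of the larger over the smaller counts, and it grows when the
    former is enlarged or the latter shrunk. Applied to cuts: the distance grows with the difference
    of the levels. *)
Lemma hausdorff_nested A B C D : A !=set0 -> A `<=` B -> B `<=` C -> C `<=` D ->
  hausdorff B C <= hausdorff A D.
Proof.
move=> [x Ax] AB BC CD; have D0 : D !=set0 by exists x; exact/CD/BC/AB.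
rewrite ge_max; apply/andP; split.
  apply: le_trans (excess_subset BC) _; apply: hausdorff_ge0; by exists x.
rewrite hausdorffC (le_trans _ (excess_le_hausdorff _ _))//.
exact: le_trans (excess_subl B CD) (excess_subr _ AB).
Qed.

End excess.

(** * Powers with exponents p and 1/p in the extended reals *)

Section poweR_inequalities.
Context {R : realType} (p : R) (hp : 1 <= p).
Local Open Scope ereal_scope.

Let p0 : (0 < p)%R. Proof. exact: lt_le_trans hp. Qed.

Lemma le_poweR (x y : \bar R) : 0 <= x -> x <= y -> x `^ p <= y `^ p.
Proof.
move=> x0 xy; have y0 := le_trans x0 xy.
by apply: gt0_ler_poweR; rewrite ?in_itv/= ?leey ?andbT// ltW.
Qed.

Lemma poweRD_le (x y : \bar R) : 0 <= x -> 0 <= y ->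
  (x + y) `^ p <= (2 `^ p)%:E * (x `^ p + y `^ p).
Proof.
move=> x0 y0; wlog xy : x y x0 y0 / x <= y => [H|].
  by have [/H->//|/ltW/H] := leP x y; rewrite addeC [y `^ p + _]addeC => ->.
apply: (@le_trans _ _ ((2%:E * y) `^ p)).
  apply: le_poweR; first exact: adde_ge0.
  by rewrite -[2%R]/(1 + 1)%R EFinD ge0_muleDl ?lee_fin// !mul1e leeD.
rewrite poweRM ?lee_fin// poweR_EFin lee_pmul2l ?lte_fin ?powR_gt0//.
by rewrite leeDr// poweR_ge0.
Qed.

Lemma poweRV_lt (x : \bar R) (e : R) : 0 <= x -> (0 < e)%R ->
  (x `^ p^-1 < e%:E) <-> (x < (e `^ p)%:E).
Proof.
move=> x0 e0; case: x x0 => [r|_|//].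
  rewrite lee_fin poweR_EFin !lte_fin => r0; split => H.
    have := @gt0_ltr_powR _ p p0 _ _ _ _ H.
    by rewrite !nnegrE powR_ge0 ltW// -powRrM mulVf ?gt_eqF// powRr1// => ->.
  have := @gt0_ltr_powR _ p^-1 _ _ _ _ _ H.
  rewrite !nnegrE invr_gt0 p0 powR_ge0 r0 -powRrM mulfV ?gt_eqF// powRr1 ?ltW//.
  exact.
by rewrite poweRyr// invr_neq0// gt_eqF.
Qed.

Lemma poweRV_le (x y : \bar R) : 0 <= x -> x <= y -> x `^ p^-1 <= y `^ p^-1.
Proof.
move=> x0 xy; have y0 := le_trans x0 xy.
by apply: gt0_ler_poweR; rewrite ?in_itv/= ?leey ?andbT ?invr_ge0// ltW.
Qed.

Lemma poweR_lt_EFin (x : \bar R) (e : R) : 0 <= x -> (0 < e)%R ->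
  x `^ p < (e `^ p)%:E -> x < e%:E.
Proof.
move=> x0 e0; apply: contraTT; rewrite -!leNgt => ex.
by rewrite -poweR_EFin le_poweR// lee_fin ltW.
Qed.

End poweR_inequalities.

(** * Measurability of the Hausdorff distance of cuts *)

Section measurability.
Context {R : realType} {m : nat}.

(** Monotonicity in the level is the only property of cuts on which measurability of the integrands
    rests. *)
Definition decreasing_on (D : set R) (A : R -> set 'rV[R]_m) : Prop :=
  forall s t, D s -> D t -> s <= t -> A t `<=` A s.

Lemma dense_ratr_rV (x : 'rV[R]_m) (e : R) : 0 < e ->
  exists q : 'rV[rat]_m, edist (map_mx ratr q) x < e.
Proof.
move=> /(near_edist x)/nbhs_ballP[d /= d0 dA].
have /choice[q qx] (i : 'I_m) : exists q : rat, `|x 0 i - ratr q| < d.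
  have xd : x 0 i - d < x 0 i + d by lra.
  have [q] := rat_in_itvoo xd; rewrite in_itv/= => /andP[? ?]; exists q.
  by rewrite ltr_distl; apply/andP; split; lra.
exists (\row_i q i); apply: dA; split=> // i j; rewrite !mxE ord1; exact: qx.
Qed.

(** [P] is an initial piece only relative to [D]; closing it downwards in the whole line yields an
    interval with the same trace on [D]. *)
Let measurable_antitone (D : set R) (P : R -> Prop) : measurable D ->
  (forall s t, D s -> D t -> s <= t -> P t -> P s) -> measurable (D `&` P).
Proof.
move=> mD PD.
have -> : D `&` P = D `&` [set t | exists2 s, D s /\ P s & t <= s].
  apply/seteqP; split=> t [Dt]; first by move=> Pt; split=> //; exists t.
  by move=> [s [Ds Ps] ts]; split=> //; exact: PD Ps.
apply: measurableI => //.
apply: is_interval_measurable.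
by move=> a b _ [s Ps bs] c /andP[_ cb]; exists s => //; exact: le_trans bs.
Qed.

Let measurable_monotone (D : set R) (P : R -> Prop) : measurable D ->
  (forall s t, D s -> D t -> s <= t -> P s -> P t) -> measurable (D `&` P).
Proof.
move=> mD PD.
have -> : D `&` P = D `&` [set t | exists2 s, D s /\ P s & s <= t].
  apply/seteqP; split=> t [Dt]; first by move=> Pt; split=> //; exists t.
  by move=> [s [Ds Ps] ts]; split=> //; exact: PD Ps.
apply: measurableI => //.
apply: is_interval_measurable.
by move=> a b [s Ps sa] _ c /andP[ac _]; exists s => //; exact: le_trans ac.
Qed.

(* [excess A B] exceeds [y] iff for some rational point [x] and rational [s]
   the set [A] meets the ball of radius [s] around [x] while [B] avoids the
   one of radius [s + y]; for decreasing families each of the two conditions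
   cuts out an interval. *)
Lemma measurable_excess (D : set R) (A B : R -> set 'rV[R]_m) :
  measurable D -> decreasing_on D A -> decreasing_on D B ->
  measurable_fun D (fun t => excess (A t) (B t)).
Proof.
move=> mD AD BD _; apply: (measurability _ (ErealGenOInfty.measurableE R)) => //.
move=> _ [_ [y ->] <-].
pose P (q : 'rV[rat]_m * rat) t :=
  exists2 a, A t a & edist a (map_mx ratr q.1) < ratr q.2.
pose Q (q : 'rV[rat]_m * rat) t :=
  forall b, B t b -> ratr q.2 + y < edist (map_mx ratr q.1) b.
rewrite [X in measurable X](_ : _ = \bigcup_q ((D `&` P q) `&` (D `&` Q q))).
  apply: countable_bigcupT_measurable; first exact: countableP.
  move=> q; apply: measurableI.
    apply: measurable_antitone => // s t Ds Dt st [a].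
    by move=> /(AD _ _ Ds Dt st); exists a.
  apply: measurable_monotone => // s t Ds Dt st sB b.
  by move=> /(BD _ _ Ds Dt st)/sB.
apply/seteqP; split => [t [Dt]|t [q _ [[Dt [a Aa aq]] [_ qB]]]].
  rewrite /= in_itv/= andbT => /excess_gt[a Aa [s ys aB]].
  have e0 : 0 < (s - y) / 3 by rewrite divr_gt0// subr_gt0.
  have [q qa] := dense_ratr_rV a e0.
  have [r] := rat_in_itvoo qa; rewrite in_itv/= => /andP[qr re].
  exists (q, r) => //; split; split => //.
    by exists a => //=; rewrite edistC.
  move=> b /aB sab /=.
  have := edist_triangle (map_mx ratr q) a b; rewrite (edistC a (map_mx _ _)).
  move: qa qr sab; lra.
split=> //; rewrite /= in_itv/= andbT.
set x := map_mx ratr q.1 in aq qB.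
apply: (@lt_le_trans _ _ (y + (ratr q.2 - edist a x))%:E).
  by rewrite lte_fin ltrDl subr_gt0.
apply: (excess_ge Aa) => b /qB; have := edist_triangle a x b.
rewrite (edistC x a); lra.
Qed.

Lemma measurable_hausdorff (D : set R) (A B : R -> set 'rV[R]_m) :
  measurable D -> decreasing_on D A -> decreasing_on D B ->
  measurable_fun D (fun t => hausdorff (A t) (B t)).
Proof. by move=> mD AD BD; apply: measurable_maxe; exact: measurable_excess. Qed.

Lemma measurable_hausdorff_poweR (p : R) (D : set R) (A B : R -> set 'rV[R]_m) :
  measurable D -> decreasing_on D A -> decreasing_on D B ->
  measurable_fun D (fun t => hausdorff (A t) (B t) `^ p)%E.
Proof.
move=> mD AD BD; apply: (measurableT_comp (measurable_poweR p)).
exact: measurable_hausdorff.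
Qed.

End measurability.

(** * Limits along ultrafilters *)

Lemma subsequence (P : nat -> nat -> Prop) :
  (forall N k, exists2 n, (k < n)%N & P N n) ->
  exists2 phi : nat -> nat, {homo phi : i j / (i < j)%N} & forall N, P N (phi N).
Proof.
move=> H; have /choice[f fP] (Nk : nat * nat) :
    exists n, (Nk.2 < n)%N /\ P Nk.1 n.
  by have [n] := H Nk.1 Nk.2; exists n.
pose phi := fix phi n := if n is n'.+1 then f (n'.+1, phi n') else f (0, 0)%N.
exists phi; last first.
  by case=> [|n]; [exact: (fP (0, 0)%N).2|exact: (fP (n.+1, phi n)).2].
by apply: homo_ltn => [? ? ?|n]; [exact: ltn_trans|exact: (fP (n.+1, phi n)).1].
Qed.

(** Diagonal extraction: the index number N is taken from the intersection of the first N + 1 sets,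
    which belongs to [F] and therefore meets every tail. *)
Lemma subsequence_filter (F : set_system nat) (P : nat -> set nat) :
  ProperFilter F -> \oo `<=` F -> (forall j, F (P j)) ->
  exists2 phi : nat -> nat, {homo phi : i j / (i < j)%N} &
    forall j n, (j <= n)%N -> P j (phi n).
Proof.
move=> FF ooF FP.
have [|phi phimon phiP] :=
    @subsequence (fun N n => forall j, (j <= N)%N -> P j n); last first.
  by exists phi => // j n; exact: phiP.
move=> N k; have FPN : F [set n | forall j, (j <= N)%N -> P j n].
  elim: N => [|N IH]; first by apply: filterS (FP 0%N) => n Pn j; rewrite leqn0 => /eqP->.
  apply: filterS2 IH (FP N.+1) => n Pn PNn j.
  by rewrite leq_eqVlt => /orP[/eqP->//|/Pn].
have Fk : F [set n | (k < n)%N] by apply: ooF; exact: nbhs_infty_gt.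
by have [n [nP kn]] := filter_ex (filterI FPN Fk); exists n.
Qed.

Section ultrafilter_limits.
Context {R : realType} {m : nat} {F : set_system nat} {UF : UltraFilter F}.
Implicit Types A : nat -> set 'rV[R]_m.

(** Compactness of the ball gives a cluster point. Along an ultrafilter it is a limit, for otherwise
    the complement of some ball around it would belong to the filter. *)
Lemma ultra_bounded (x : nat -> 'rV[R]_m) (K : R) :
  F [set n | enorm (x n) <= K] ->
  exists y, forall e : R, 0 < e -> F [set n | edist (x n) y < e].
Proof.
move=> xK; have [y [_ yx]] := @compact_eball R m K (x @ F) _ xK.
exists y => e e0; set S := [set n | _].
have [//|FS] := in_ultra_setVsetC S UF.
have [z []] := yx [set z | ~ edist z y < e] _ FS (near_edist y e0).
by [].
Qed.

(** The Kuratowski lower limit along [F]; for an ultrafilter it agrees with the upper limit, so that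
    it serves as the limit of any sequence of sets, without prior extraction. *)
Definition ulim A : set 'rV[R]_m :=
  [set x | forall e : R, 0 < e -> F [set n | exists2 a, A n a & edist a x < e]].

Lemma ulim_seq A (x : nat -> 'rV[R]_m) y : F [set n | A n (x n)] ->
  (forall e : R, 0 < e -> F [set n | edist (x n) y < e]) -> ulim A y.
Proof.
by move=> Ax xy e e0; apply: filterS2 Ax (xy _ e0) => n Anx xye; exists (x n).
Qed.

Lemma closed_ulim A : closed (ulim A).
Proof.
apply: closed_edist => x xA e e0; have e20 : 0 < e / 2 by rewrite divr_gt0.
have [y yA yx] := xA _ e20; apply: filterS (yA _ e20) => n [a Aa ay].
exists a => //; apply: (le_lt_trans (edist_triangle y _ _)).
by rewrite [e]splitr ltrD.
Qed.

Lemma ulim_sub_eball A (K : R) : F [set n | A n `<=` eball K] ->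
  ulim A `<=` eball K.
Proof.
move=> AK x xA; apply/ler_addgt0Pl => e e0.
have [n [AnK [a Aa ax]]] := filter_ex (filterI AK (xA _ e0)).
by rewrite (le_trans (enorm_triangle a _))// edistC lerD ?(ltW ax)//; exact: AnK.
Qed.

(* Blaschke selection along an ultrafilter: a sequence of points violating the
   claim would itself have a limit, which lies in [ulim A]. *)
Lemma hausdorff_ulim A (K e : R) : F [set n | A n `<=` eball K] -> 0 < e ->
  F [set n | (hausdorff (A n) (ulim A) <= e%:E)%E].
Proof.
move=> AK e0; have e20 : 0 < e / 2 by rewrite divr_gt0.
have H1 : F [set n | (excess (A n) (ulim A) <= e%:E)%E].
  set S := [set n | _]; have [//|FS] := in_ultra_setVsetC S UF.
  have /choice[x xP] n : exists a, ~ S n ->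
      A n a /\ forall b, ulim A b -> e < edist a b.
    have [Sn|] := pselect (S n); first by exists 0.
    move/negP; rewrite -ltNge => /excess_gt[a Aa [s es sb]].
    by exists a => _; split=> // b /sb; exact: lt_le_trans.
  have [|y xy] := @ultra_bounded x K.
    by apply: filterS2 AK FS => n AnK /xP[/AnK].
  have yA : ulim A y by apply: ulim_seq xy; apply: filterS FS => n /xP[].
  have [n [/xP[_ /(_ y yA) exy] yxe]] := filter_ex (filterI FS (xy _ e0)).
  by have := lt_trans exy yxe; rewrite ltxx.
have H2 : F [set n | (excess (ulim A) (A n) <= e%:E)%E].
  set S := [set n | _]; have [//|FS] := in_ultra_setVsetC S UF.
  have /choice[x xP] n : exists b, ~ S n ->
      ulim A b /\ forall a, A n a -> e < edist b a.
    have [Sn|] := pselect (S n); first by exists 0.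
    move/negP; rewrite -ltNge => /excess_gt[b Ab [s es sb]].
    by exists b => _; split=> // a /sb; exact: lt_le_trans.
  have [|y xy] := @ultra_bounded x K.
    by apply: filterS FS => n /xP[/(ulim_sub_eball AK)].
  have yA : ulim A y.
    apply: (closed_edistP (@closed_ulim A)) => d d0.
    have [n [/xP[xA _] xyd]] := filter_ex (filterI FS (xy _ d0)).
    by exists (x n).
  have [n [[/xP[_ nA] xye] [a Aa ay]]] :=
    filter_ex (filterI (filterI FS (xy _ e20)) (yA _ e20)).
  have := edist_triangle y (x n) a; have := nA _ Aa; rewrite (edistC y a).
  by rewrite /= in xye; lra.
by apply: filterS2 H1 H2 => n h1 h2; rewrite /hausdorff/= ge_max h1.
Qed.

End ultrafilter_limits.
Arguments ulim {R m} F A.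

Lemma bounded_cluster {R : realType} {m : nat} (x : nat -> 'rV[R]_m) (K : R) :
  (forall n, enorm (x n) <= K) -> exists y, forall (e : R) N, 0 < e ->
    exists2 n, (N <= n)%N & edist (x n) y < e.
Proof.
move=> xK; have [F [UF ooF]] := @ultraFilterLemma _ \oo _.
have [|y xy] := @ultra_bounded R m F UF x K; first exact: filterE.
exists y => e N e0; have FN : F [set n | (N <= n)%N] by apply: ooF; exists N.
by have [n [Nn nx]] := filter_ex (filterI FN (xy _ e0)); exists n.
Qed.

(** * Integration *)

Section extended_real_limits.
Context {R : realType}.
Local Open Scope ereal_scope.
Implicit Types f : nat -> \bar R.

Lemma cvge0P f : (forall n, 0 <= f n) ->
  f n @[n --> \oo] --> 0 <->
  forall e : R, (0 < e)%R -> \forall n \near \oo, f n < e%:E.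
Proof.
move=> f0; split=> [/fine_cvgP[ffin /cvgrPdist_lt f0'] e e0|H].
  near=> n; rewrite -[f n]fineK; last by near: n.
  rewrite lte_fin; apply: le_lt_trans (ler_norm _) _.
  by rewrite -[fine _]opprK normrN -[(- _)%R]add0r; near: n; exact: f0'.
apply/fine_cvgP; split.
  near=> n; rewrite ge0_fin_numE// (@lt_trans _ _ 1%:E) ?ltry//.
  by near: n; exact: H.
apply/cvgrPdist_lt => e e0; near=> n.
rewrite sub0r normrN ger0_norm ?fine_ge0// -lte_fin fineK.
  by near: n; exact: H.
rewrite ge0_fin_numE// (@lt_trans _ _ 1%:E) ?ltry//.
by near: n; exact: H.
Unshelve. all: by end_near. Qed.

Lemma limn_einf_ereal_sup f : limn_einf f = ereal_sup (range (einfs f)).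
Proof.
rewrite limn_einf_lim; apply/cvg_lim => //.
exact: ereal_nondecreasing_cvgn (nondecreasing_einfs f).
Qed.

Lemma limn_einf_lt f (c : \bar R) N : limn_einf f < c ->
  exists2 n, (N <= n)%N & f n < c.
Proof.
rewrite limn_einf_ereal_sup => fc.
have /ereal_inf_lt[_ [n /= Nn <-] fnc] : einfs f N < c.
  by apply: le_lt_trans fc; apply: ereal_sup_ubound; exists N.
by exists n.
Qed.

Lemma limn_einf_le f (c : \bar R) : (\forall n \near \oo, f n <= c) -> limn_einf f <= c.
Proof.
move=> [N _ Nc]; rewrite limn_einf_ereal_sup; apply: ge_ereal_sup => _ [n _ <-].
apply: ge_ereal_inf; exists (f (maxn n N)).
  by exists (maxn n N) => //=; exact: leq_maxl.
by apply: Nc; exact: leq_maxr.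
Qed.

Lemma measurable_fun_limn_einf d (T : measurableType d) (D : set T)
    (f : nat -> T -> \bar R) :
  (forall n, measurable_fun D (f n)) ->
  measurable_fun D (fun x => limn_einf (f ^~ x)).
Proof.
move=> mf; apply: measurableT_comp => //.
by apply: measurable_fun_limn_esup => n; exact: measurableT_comp.
Qed.

End extended_real_limits.

(** * Translation invariance of Lebesgue measure *)

Section lebesgue_translation.
Context {R : realType}.
Local Open Scope ereal_scope.
Local Notation mu := (@lebesgue_measure R).

Let shift (h : R) : R -> measurableTypeR R := fun a => (a - h)%R.

Let measurable_shift h : measurable_fun setT (shift h).
Proof. exact: measurable_funB. Qed.

Let shift_preimage h (b0 b1 : bool) (a b : R) :
  shift h @^-1` [set` Interval (BSide b0 a) (BSide b1 b)] =
  [set` Interval (BSide b0 (a + h)%R) (BSide b1 (b + h)%R)].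
Proof.
by case: b0; case: b1; apply/seteqP; split=> x;
  rewrite /= !in_itv/= /shift ?lerBrDr ?lerBlDr ?ltrBrDr ?ltrBlDr.
Qed.

(** By uniqueness of Lebesgue measure it suffices to compare lengths of half-open intervals. *)
Lemma lebesgue_measure_shift h (A : set R) : measurable A ->
  pushforward mu (shift h) A = mu A.
Proof.
move=> mA; apply/esym/lebesgue_measure_unique => //=.
  exact: measurable_shift.
move=> mphi _ [[a b]] _ <-.
rewrite /pushforward /= shift_preimage // !lebesgue_measure_itv/=.
rewrite !lte_fin ltrD2r; case: ifPn => // _; rewrite -!EFinB; congr EFin.
lra.
Qed.

Lemma ge0_integral_shift (f : R -> \bar R) (a b h : R) :
  measurable_fun `[a, b] f -> (forall x, `[a, b]%classic x -> 0 <= f x) ->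
  \int[mu]_(x in `[(a + h)%R, (b + h)%R]) f (x - h)%R = \int[mu]_(x in `[a, b]) f x.
Proof.
move=> mf f0; rewrite -(shift_preimage h).
rewrite -ge0_integral_pushforward//=; last first.
- by move=> x; rewrite inE => /f0.
- exact: measurable_shift.
apply: eq_measure_integral; first exact: measurable_shift.
by move=> mshift A mA _; exact: lebesgue_measure_shift.
Qed.

End lebesgue_translation.

(** * Cuts and the integral of the Hausdorff distance *)

Section cuts.
Context {R : realType} {m : nat}.
Implicit Types (u v : fuzzy R m) (B : set 'rV[R]_m).

Lemma cutE u a : 0 < a -> cut u a = [set x | a <= u x].
Proof. by move=> a0; rewrite /cut gt_eqF. Qed.

Lemma cut_decreasing u s t : 0 <= s -> s <= t -> cut u t `<=` cut u s.
Proof.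
move=> s0 st x; rewrite /cut; case: eqP => [t0|t0].
  suff -> : s = 0 by rewrite eqxx.
  by apply/le_anti; rewrite s0 andbT -t0.
have {}t0 : 0 < t by rewrite lt_def (le_trans s0 st) andbT; exact/eqP.
move=> /= tx; case: eqP => _; last exact: le_trans tx.
by apply: subset_closure; exact: lt_le_trans tx.
Qed.

Lemma cut_nonempty u a : normal_fuzzy u -> a <= 1 -> cut u a !=set0.
Proof.
move=> [x ux] a1; exists x; rewrite /cut; case: eqP => _; last by rewrite /= ux.
by apply: subset_closure; rewrite /= ux.
Qed.

Lemma FB_cut_bounded u : FB u ->
  exists2 K : R, 0 <= K & forall a, 0 <= a -> cut u a `<=` eball K.
Proof.
move=> [_ _ _ [K uK]]; exists (Num.max K 0); first by rewrite le_max lexx orbT.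
move=> a a0 x /(cut_decreasing (lexx 0) a0) /uK xK.
by rewrite /eball/= le_max xK.
Qed.

Lemma closed_cut u a : upper_semicontinuous u -> 0 < a -> closed (cut u a).
Proof.
move=> uu a0; rewrite cutE//; apply: closed_edist => x xu.
rewrite /= leNgt; apply/negP => /uu /near_sub_edist[e e0 eu].
by have [y /= ay /eu] := xu _ e0; rewrite ltNge ay.
Qed.

Let indic_ge (B : set 'rV[R]_m) (a : R) x :
  0 < a <= 1 -> a <= (\1_B : 'rV[R]_m -> R) x <-> B x.
Proof.
move=> /andP[a0 a1]; rewrite indicE; split => [|Bx]; last by rewrite mem_set.
by case: (boolP (x \in B)) => [/set_mem//|_]; rewrite leNgt a0.
Qed.

Let indic_gt0 (B : set 'rV[R]_m) x : 0 < (\1_B : 'rV[R]_m -> R) x <-> B x.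
Proof.
rewrite indicE; split => [|Bx]; last by rewrite mem_set.
by case: (boolP (x \in B)) => [/set_mem//|_]; rewrite ltxx.
Qed.

Lemma cut_max_indic u B a : closed B -> 0 <= a <= 1 ->
  cut (u \max \1_B) a = cut u a `|` B.
Proof.
move=> cB /andP[a0 a1]; rewrite /cut; case: eqP => [_|/eqP an0].
  rewrite [in RHS](closure_id B).1// -closureU; congr closure.
  apply/seteqP; split => x /=; rewrite lt_max.
    by move=> /orP[|/indic_gt0]; [left|right].
  by move=> [->//|/indic_gt0 ->]; rewrite orbT.
have {}a0 : 0 < a <= 1 by rewrite lt_def an0 a0.
apply/seteqP; split => x /=; rewrite le_max.
  by move=> /orP[|/(indic_ge _ _ a0)]; [left|right].
by move=> [->//|/(indic_ge _ _ a0) ->]; rewrite orbT.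
Qed.

Lemma cut_indic B a : closed B -> 0 <= a <= 1 -> cut (\1_B : fuzzy R m) a = B.
Proof.
move=> cB /andP[a0 a1]; rewrite /cut; case: eqP => [_|/eqP an0].
  rewrite [RHS](closure_id B).1//; congr closure.
  by apply/seteqP; split => x /= /indic_gt0.
have {}a0 : 0 < a <= 1 by rewrite lt_def an0 a0.
by apply/seteqP; split => x /= /(indic_ge _ _ a0).
Qed.

End cuts.

Section integrals.
Context {R : realType} {m : nat} (p : R) (hp : 1 <= p).
Local Open Scope ereal_scope.
Local Notation mu := (@lebesgue_measure R).
Implicit Types (A B C : R -> set 'rV[R]_m) (u v w : fuzzy R m).

Lemma integral_poweRD_le (D : set R) (f g k : R -> \bar R) :
  measurable D -> measurable_fun D f -> measurable_fun D g -> measurable_fun D k ->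
  (forall a, D a -> [/\ 0 <= f a, 0 <= g a, 0 <= k a & f a <= g a + k a]) ->
  \int[mu]_(a in D) (f a `^ p) <=
    (2 `^ p)%:E * (\int[mu]_(a in D) (g a `^ p) + \int[mu]_(a in D) (k a `^ p)).
Proof.
move=> mD mf mg mk H.
have mpow (h : R -> \bar R) : measurable_fun D h ->
    measurable_fun D (fun a => h a `^ p).
  by move=> mh; apply: (measurableT_comp (measurable_poweR p)).
rewrite -ge0_integralD//; try exact: mpow; try by move=> a Da; exact: poweR_ge0.
have mgk : measurable_fun D (fun a => g a `^ p + k a `^ p).
  by apply: emeasurable_funD; exact: mpow.
have gk0 a : D a -> 0 <= g a `^ p + k a `^ p by rewrite adde_ge0 ?poweR_ge0.
rewrite -ge0_integralZl ?lee_fin ?powR_ge0//.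
apply: ge0_le_integral => //.
- by move=> a _; exact: poweR_ge0.
- exact: mpow.
- exact: measurable_funeM.
- move=> a /H[f0 g0 k0 fgk]; apply: le_trans (poweRD_le hp g0 k0).
  exact: le_poweR.
Qed.

Lemma integral_hausdorff_triangle (D : set R) A B C :
  measurable D -> decreasing_on D A -> decreasing_on D B -> decreasing_on D C ->
  (forall a, D a -> [/\ A a !=set0, B a !=set0 & C a !=set0]) ->
  \int[mu]_(a in D) (hausdorff (A a) (C a) `^ p) <= (2 `^ p)%:E *
    (\int[mu]_(a in D) (hausdorff (A a) (B a) `^ p) +
     \int[mu]_(a in D) (hausdorff (B a) (C a) `^ p)).
Proof.
move=> mD dA dB dC ne.
apply: integral_poweRD_le; try exact: measurable_hausdorff.
- by [].
- move=> a Da; have [A0 B0 C0] := ne a Da.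
  by split; [exact: hausdorff_ge0..|exact: hausdorff_triangle].
Qed.

Lemma decreasing_cut u : decreasing_on `[0%R, 1%R] (cut u).
Proof. by move=> s t; rewrite /= !in_itv/= => /andP[s0 _] _; exact: cut_decreasing. Qed.

Lemma decreasing_cut_shift u (h b : R) :
  decreasing_on `[h, b] (fun a => cut u (a - h)%R).
Proof.
move=> s t; rewrite /= !in_itv/= => /andP[hs _] _ st.
by apply: cut_decreasing; rewrite ?subr_ge0 ?lerD2r.
Qed.

Definition dp_pow u v : \bar R :=
  \int[mu]_(a in `[0%R, 1%R]) (hausdorff (cut u a) (cut v a) `^ p).

Lemma dp_pow_ge0 u v : 0 <= dp_pow u v.
Proof. by apply: integral_ge0 => a _; exact: poweR_ge0. Qed.

Lemma dp_powC u v : dp_pow u v = dp_pow v u.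
Proof. by apply: eq_integral => a _; rewrite hausdorffC. Qed.

Lemma dp_lt u v (e : R) : (0 < e)%R -> dp p u v < e%:E <-> dp_pow u v < (e `^ p)%:E.
Proof. by move=> e0; apply: poweRV_lt => //; exact: dp_pow_ge0. Qed.

Lemma dp_lt_powRV u v (e : R) : (0 < e)%R ->
  dp p u v < (e `^ p^-1)%:E <-> dp_pow u v < e%:E.
Proof.
move=> e0; rewrite dp_lt ?powR_gt0// -powRrM mulVf ?powRr1// ?ltW//.
by rewrite gt_eqF// (lt_le_trans _ hp).
Qed.

Lemma dp_pow_triangle v u w :
  normal_fuzzy u -> normal_fuzzy v -> normal_fuzzy w ->
  dp_pow u w <= (2 `^ p)%:E * (dp_pow u v + dp_pow v w).
Proof.
move=> nu nv nw; apply: integral_hausdorff_triangle; try exact: decreasing_cut.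
  by [].
move=> a; rewrite /= in_itv/= => /andP[_ a1].
by split; exact: cut_nonempty.
Qed.

Lemma dp_pow_triangle_lt v u w (e : R) :
  normal_fuzzy u -> normal_fuzzy v -> normal_fuzzy w ->
  dp_pow u v < e%:E -> dp_pow v w < e%:E ->
  dp_pow u w < (2 `^ p * (2 * e))%:E.
Proof.
move=> nu nv nw uv vw; apply: le_lt_trans (dp_pow_triangle nu nv nw) _.
rewrite EFinM lte_pmul2l ?lte_fin ?powR_gt0// mulr2n mulrDl mul1r EFinD.
exact: lteD uv vw.
Qed.

End integrals.

(** * Compactness in [(X, d_p)] *)

Section dp_topology.
Context {R : realType} {m : nat} (p : R) (hp : 1 <= p) (X : set (fuzzy R m)).
Context (XFB : X `<=` @FB R m).
Local Notation T := (dp_space p X).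
Local Notation K := (2 `^ p).

Let nX (x : T) : normal_fuzzy (val x).
Proof. by have [] := XFB (set_valP x). Qed.

Let K0 : 0 < K. Proof. by rewrite powR_gt0. Qed.

Lemma dp_pow_xx (u : fuzzy R m) : normal_fuzzy u -> dp_pow p u u = 0%E.
Proof.
move=> nu; apply: integral0_eq => a; rewrite /= in_itv/= => /andP[_ a1].
rewrite (hausdorffxx (cut_nonempty nu a1)) poweR0r//.
by rewrite gt_eqF// (lt_le_trans _ hp).
Qed.

(** The radius [e / (K * 2)] takes the place of e / 2: the quasi-triangle inequality multiplies the
    sum of two such radii by [K]. *)
Let dp_pow_lt_half (x y z : T) (e : R) :
  (dp_pow p (val x) (val y) < (e / (K * 2))%:E)%E ->
  (dp_pow p (val y) (val z) < (e / (K * 2))%:E)%E ->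
  (dp_pow p (val x) (val z) < e%:E)%E.
Proof.
move=> xy yz; have := dp_pow_triangle_lt hp (nX x) (nX y) (nX z) xy yz.
by rewrite mulrA mulrC divfK// gt_eqF// mulr_gt0.
Qed.

Lemma nbhs_dp_pow (x : T) (e : R) : 0 < e ->
  nbhs x [set y : T | (dp_pow p (val x) (val y) < e%:E)%E].
Proof.
move=> e0; rewrite nbhsE; set B := [set y : T | _].
(* The quasi-triangle inequality does not show that the ball [B] is open. The open set is instead
   the set of points around which some [dp_pow] ball is contained in [B]. *)
exists [set y : T | exists2 d : R, 0 < d & forall z : T,
    (dp_pow p (val y) (val z) < d%:E)%E -> B z]; last first.
  by move=> y [d d0]; apply; rewrite dp_pow_xx ?lte_fin.
split; last by exists e.
move=> y [d d0 dB]; pose d' := d / (K * 2).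
have d'0 : 0 < d' by rewrite divr_gt0// mulr_gt0.
exists (d' `^ p^-1); first by rewrite powR_gt0.
move=> z /(dp_lt_powRV hp _ _ d'0) yz; exists d' => // t zt; apply: dB.
exact: dp_pow_lt_half yz zt.
Qed.

Lemma nbhs_dp_powP (x : T) (A : set T) : nbhs x A ->
  exists2 e : R, 0 < e & forall y : T, (dp_pow p (val x) (val y) < e%:E)%E -> A y.
Proof.
rewrite nbhsE => -[B [oB Bx] BA]; have [e e0 eB] := oB x Bx.
exists (e `^ p); first by rewrite powR_gt0.
by move=> y /(dp_lt hp _ _ e0) xy; exact/BA/eB.
Qed.

Lemma compact_dp_cluster (C : set T) (u : nat -> T) : compact C ->
  (forall n, C (u n)) -> exists x : T,
    forall (e : R) N, 0 < e -> exists2 n, (N <= n)%N &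
      (dp_pow p (val x) (val (u n)) < e%:E)%E.
Proof.
move=> cC uC; have uooC : (u @ \oo) C by exists 0%N => // n _; exact: uC.
have [x [_ ux]] := cC (u @ \oo) _ uooC.
exists x => e N e0; have uN : (u @ \oo) (u @` [set n | (N <= n)%N]).
  by exists N => // n /= Nn; exists n.
by have [_ [[n Nn <-] xn]] := ux _ _ uN (nbhs_dp_pow x e0); exists n.
Qed.

Context (U : set T).

(** The points already chosen are kept in the list [l n], and [f] picks the next one far from all of
    them. On lists that leave [U] the value of [f] is arbitrary; no [l n] is of that kind. *)
Let separated_sequence (e : R) :
  (forall s : seq T, (forall x, x \in s -> U x) -> exists2 y, U y &
    forall x, x \in s -> ~ (dp_pow p (val x) (val y) < e%:E)%E) ->
  exists2 u : nat -> T, forall n, U (u n) &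
    forall i n, (i < n)%N -> ~ (dp_pow p (val (u i)) (val (u n)) < e%:E)%E.
Proof.
move=> H; have /choice[f fP] (s : seq T) : exists y, (forall x, x \in s -> U x) ->
    U y /\ forall x, x \in s -> ~ (dp_pow p (val x) (val y) < e%:E)%E.
  have [sU|sU] := pselect (forall x, x \in s -> U x).
    by have [y Uy sy] := H s sU; exists y.
  by have [|y Uy _] := H [::]; [by []|exists y => /sU].
pose l n := iter n (fun s => f s :: s) [::].
have lU n x : x \in l n -> U x.
  elim: n x => [|n IH] x; first by rewrite in_nil.
  rewrite [l _]/= in_cons => /orP[/eqP ->|]; last exact: IH.
  by have [] := fP _ IH.
exists (fun n => f (l n)) => [n|i n iltn]; first by have [] := fP _ (lU n).
have [_] := fP _ (lU n); apply.
elim: n iltn => [//|n IH]; rewrite ltnS leq_eqVlt => /orP[/eqP->|/IH H'].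
  by rewrite [l _]/= in_cons eqxx.
by rewrite [l _]/= in_cons H' orbT.
Qed.

(* Otherwise no ball of some radius around a point of [U] belongs to the
   ultrafilter, and one picks a separated sequence in [U]. *)
Lemma ultra_dp_ball (F : set_system T) (e : R) : UltraFilter F ->
  F (closure U) ->
  (forall u : nat -> T, (forall n, U (u n)) -> exists x : T,
    forall (e : R) N, 0 < e -> exists2 n, (N <= n)%N &
      (dp_pow p (val x) (val (u n)) < e%:E)%E) ->
  0 < e -> exists2 x, U x & F [set y : T | (dp_pow p (val x) (val y) < e%:E)%E].
Proof.
move=> UF FU Useq e0; apply: contrapT => noball.
pose d := e / (K * 2); have d0 : 0 < d by rewrite divr_gt0// mulr_gt0.
have [|u uU usep] := @separated_sequence d.
  move=> s sU; have : F (closure U `&`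
      [set y : T | forall x, x \in s -> ~ (dp_pow p (val x) (val y) < e%:E)%E]).
    apply: filterI => //; elim: s sU => [|x s IH] sU; first exact: filterE.
    have Fs : F [set y : T | forall x, x \in s ->
        ~ (dp_pow p (val x) (val y) < e%:E)%E].
      by apply: IH => z zs; apply: sU; rewrite inE zs orbT.
    have [Fx|Fx] := in_ultra_setVsetC
        [set y : T | (dp_pow p (val x) (val y) < e%:E)%E] UF.
      by exfalso; apply: noball; exists x => //; apply: sU; rewrite inE eqxx.
    by apply: filterS2 Fs Fx => y ys yx z; rewrite inE => /orP[/eqP->|/ys].
  move=> /filter_ex[z [Uz zs]].
  (* [z] lies only in the closure of [U]. A point [y] of [U] within [d] of [z] is still not within
     [d] of any point of [s], since that point would then be within [e] of [z]. *)
  have [y [Uy zy]] := Uz _ (nbhs_dp_pow z d0); exists y => // x /zs xz xy; apply: xz.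
  by move: zy; rewrite /= dp_powC => zy; exact: dp_pow_lt_half xy zy.
pose d1 := d / (K * 2); have d10 : 0 < d1 by rewrite divr_gt0// mulr_gt0.
have [x xu] := Useq u uU.
have [i _ xi] := xu d1 0%N d10; have [n in_ xn] := xu d1 i.+1 d10.
rewrite dp_powC in xi; apply: (usep i n in_).
exact: dp_pow_lt_half xi xn.
Qed.

(** An ultrafilter containing the closure contains balls of radius 1 / (n + 1) around points u_n of
    [U]. Once n is large and u_n is close to a cluster point of these centers, such a ball lies in a
    given neighbourhood of that point, to which the ultrafilter therefore converges. *)
Lemma sequentially_compact_dp :
  (forall u : nat -> T, (forall n, U (u n)) -> exists x : T,
    forall (e : R) N, 0 < e -> exists2 n, (N <= n)%N &
      (dp_pow p (val x) (val (u n)) < e%:E)%E) ->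
  compact (closure U).
Proof.
move=> Useq; rewrite compact_ultra => F UF FU.
have /choice[u uP] n : exists x, U x /\
    F [set y : T | (dp_pow p (val x) (val y) < (n.+1%:R^-1)%:E)%E].
  have [|x Ux Fx] := @ultra_dp_ball F n.+1%:R^-1 UF FU Useq.
    by rewrite invr_gt0.
  by exists x.
have [x xu] := Useq u (fun n => (uP n).1); exists x; split.
  move=> B /nbhs_dp_powP[e e0 eB]; have [n _ xn] := xu e 0%N e0.
  by exists (u n); split; [exact: (uP n).1|exact: eB].
move=> B /nbhs_dp_powP[e e0 eB].
pose d := e / (K * 2); have d0 : 0 < d by rewrite divr_gt0// mulr_gt0.
have [N Nd] : exists N : nat, d^-1 < N%:R.
  by exists (Num.bound d^-1); rewrite archi_boundP// invr_ge0 ltW.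
have [n Nn xn] := xu d N d0.
apply: filterS (uP n).2 => y uny; apply: eB.
apply: (dp_pow_lt_half xn); apply: lt_trans uny _.
rewrite lte_fin -[ltRHS]invrK ltf_pV2 ?posrE ?invr_gt0//.
by apply: (lt_le_trans Nd); rewrite ler_nat leqW.
Qed.

End dp_topology.

(** * Mean left continuity *)

Section mean_left_continuity.
Context {R : realType} {m : nat} (p : R) (hp : 1 <= p).
Local Open Scope ereal_scope.
Local Notation mu := (@lebesgue_measure R).
Implicit Types (u v : fuzzy R m).

Lemma integral_hausdorff_le (A B : R -> set 'rV[R]_m) (s t c : R) :
  (s <= t)%R -> decreasing_on `[s, t] A -> decreasing_on `[s, t] B ->
  (forall a, (s <= a <= t)%R -> 0 <= hausdorff (A a) (B a) <= c%:E) ->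
  \int[mu]_(a in `[s, t]) (hausdorff (A a) (B a) `^ p) <= (c `^ p * (t - s))%:E.
Proof.
move=> st dA dB Hc.
apply: (@le_trans _ _ (\int[mu]_(a in `[s, t]) cst (c `^ p)%:E a)).
  apply: ge0_le_integral => //.
  - by move=> a _; exact: poweR_ge0.
  - exact: measurable_hausdorff_poweR.
  - move=> a; rewrite /= in_itv/= => /Hc/andP[H0 H1].
    by rewrite -poweR_EFin; exact: le_poweR.
rewrite integral_cst//= lebesgue_measure_itv/= lte_fin.
case: ltP => [_|ts]; first by rewrite -EFinB -EFinM.
by rewrite mule0 lee_fin mulr_ge0 ?powR_ge0// subr_ge0.
Qed.

(** Otherwise points of the cuts just below [a] stay [e] away from [cut u a]; they are bounded, and
    by closedness of the cuts their limit has grade at least [a]. The levels are truncated at 0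
    because a cut at a negative level is the whole space. *)
Lemma cut_left_continuous u (a e : R) : FB u -> (0 < a)%R -> (0 < e)%R ->
  exists N : nat,
    hausdorff (cut u a) (cut u (Num.max (a - N.+1%:R^-1) 0)%R) <= e%:E.
Proof.
move=> uFB a0 e0; have [_ _ uu _] := uFB; have [M M0 uM] := FB_cut_bounded uFB.
apply: contrapT => /forallNP H.
pose s (n : nat) : R := Num.max (a - n.+1%:R^-1)%R 0%R.
have sa n : (s n <= a)%R by rewrite ge_max gerBl invr_ge0 ler0n ltW.
have s0 n : (0 <= s n)%R by rewrite le_max lexx orbT.
have /choice[x xP] n : exists x, cut u (s n) x /\
    forall y, cut u a y -> (e < edist x y)%R.
  have /negP := H n; rewrite -ltNge lt_max => /orP[us|/excess_gt[x xs [d ed xd]]].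
    have := lt_le_trans us (excess_subset (cut_decreasing (s0 n) (sa n))).
    by rewrite lte_fin ltNge (ltW e0).
  by exists x; split=> // y /xd; exact: lt_le_trans.
have [F [UF ooF]] := @ultraFilterLemma _ \oo _.
have [|y xy] := @ultra_bounded R m F UF x M.
  by apply: filterE => n; exact: (uM (s n) (s0 n) _ (xP n).1).
have ya : cut u a y.
  rewrite cutE//=; apply/ler_addgt0Pr => d d0; rewrite -lerBlDr.
  have [|ad0] := leP (a - d)%R 0%R.
    by move=> /le_trans; apply; have [/(_ y)/andP[]] := uFB.
  suff : cut u (a - d)%R y by rewrite cutE.
  apply: (closed_edistP (closed_cut uu ad0)) => c c0.
  have Fd : F [set n | (n.+1%:R^-1 < d)%R].
    by apply: ooF; exact: near_infty_natSinv_lt (PosNum d0).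
  have [n [nd xyn]] := filter_ex (filterI Fd (xy _ c0)); exists (x n) => //.
  apply: cut_decreasing (xP n).1; first exact: ltW.
  by rewrite le_max lerB// ltW.
have [n /=] := filter_ex (xy _ e0).
by rewrite ltNge (ltW ((xP n).2 _ ya)).
Qed.

(** Dominated convergence along the shifts 1 / (n + 1), with the constant (2 M)^p as majorant. The
    truncation at 0 puts all integrands on the fixed interval [0, 1]; a smaller shift h gives a
    smaller distance by [hausdorff_nested]. *)
Lemma FB_mean_left_continuous u (e : R) : FB u -> (0 < e)%R ->
  exists2 d : R, (0 < d)%R & forall h : R, (0 <= h < d)%R ->
    \int[mu]_(a in `[h, 1%R]) (hausdorff (cut u a) (cut u (a - h)%R) `^ p) < e%:E.
Proof.
move=> uFB e0; have [M M0 uM] := FB_cut_bounded uFB.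
have nu : normal_fuzzy u by case: uFB.
have p0 : (0 < p)%R by rewrite (lt_le_trans _ hp).
pose s (n : nat) (a : R) : R := Num.max (a - n.+1%:R^-1)%R 0%R.
have sa n a : (0 <= a)%R -> (s n a <= a)%R.
  by move=> a0; rewrite ge_max a0 gerBl invr_ge0 ler0n.
have s0 n a : (0 <= s n a)%R by rewrite le_max lexx orbT.
have cut0 a : (a <= 1)%R -> cut u a !=set0 by exact: cut_nonempty.
pose f n a := hausdorff (cut u a) (cut u (s n a)) `^ p.
have ds n D : decreasing_on D (fun a => cut u (s n a)).
  move=> a b _ _ ab; apply: cut_decreasing => //.
  by rewrite /s ge_max !le_max lerB ?lexx ?orbT.
have mf n : measurable_fun (`[0%R, 1%R]%classic : set R) (f n).
  by apply: measurable_hausdorff_poweR => //; exact: decreasing_cut.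
have H0 n a : (a <= 1)%R -> 0 <= hausdorff (cut u a) (cut u (s n a)).
  by move=> a1; apply: hausdorff_ge0; exact: cut0.
have f_le n a : (0 <= a <= 1)%R -> f n a <= ((2 * M) `^ p)%:E.
  move=> /andP[a0 a1]; rewrite -poweR_EFin; apply: le_poweR => //; first exact: H0.
  have sa1 : (s n a <= 1)%R by exact: le_trans (sa _ _ a0) a1.
  apply: hausdorff_le => x xs.
    have [y ys] := cut0 _ sa1; exists y => //.
    rewrite (le_trans (edist_triangle 0 _ _))// edistx0 edistC edistx0.
  rewrite mulr2n mulrDl mul1r.
    by rewrite lerD//; [exact: uM xs|exact: uM ys].
  have [y ys] := cut0 _ a1; exists y => //.
  rewrite (le_trans (edist_triangle 0 _ _))// edistx0 edistC edistx0.
  rewrite mulr2n mulrDl mul1r.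
  by rewrite lerD//; [exact: uM xs|exact: uM ys].
have f_cvg a : (0 <= a <= 1)%R -> f n a @[n --> \oo] --> 0.
  move=> /andP[a0 a1]; apply/cvge0P => [n|c c0]; first exact: poweR_ge0.
  have [aE|a_neq0] := eqVneq a 0%R.
    apply: nearW => n; rewrite /f.
    have -> : s n a = a by apply/le_anti; rewrite sa//= {1}aE s0.
    by rewrite hausdorffxx ?poweR0r ?lte_fin// ?gt_eqF//; exact: cut0.
  have {}a_neq0 : (0 < a)%R by rewrite lt_def a_neq0.
  have c20 : (0 < (c / 2) `^ p^-1)%R by rewrite powR_gt0 ?divr_gt0.
  have [N HN] := cut_left_continuous uFB a_neq0 c20.
  exists N => // n /= Nn; apply: (@le_lt_trans _ _ (c / 2)%:E); last first.
    by rewrite lte_fin ltr_pdivrMr// ltr_pMr// ltr1n.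
  have cE : (c / 2 = ((c / 2) `^ p^-1) `^ p)%R.
    by rewrite -powRrM mulVf ?gt_eqF// powRr1// divr_ge0// ltW.
  rewrite [X in _ <= X%:E]cE -poweR_EFin.
  apply: le_poweR => //; first exact: H0.
  apply: le_trans HN; apply: hausdorff_nested => //; first exact: cut0.
    exact: cut_decreasing (s0 _ _) (sa _ _ a0).
  apply: (cut_decreasing (s0 N a)).
  rewrite /s ge_max !le_max lexx !orbT andbT lerB//.
  by rewrite lef_pV2 ?posrE// ler_nat.
have f0 n a : 0 <= f n a by exact: poweR_ge0.
have [|||||_ _ fint] := @dominated_convergence _ _ _ mu
  (`[0%R, 1%R]%classic : set R) _ f (cst 0)
  (cst ((2 * M) `^ p)%:E) mf.
- by [].
- exact: measurable_cst.
- by apply: aeW => a; rewrite /= in_itv/= => /f_cvg.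
- apply/integrableP; split; first exact: measurable_cst.
  have -> : (fun a : R => `|cst ((2 * M) `^ p)%:E a|) = cst `|((2 * M) `^ p)%:E| by [].
  rewrite integral_cst//= lebesgue_measure_itv/=.
  by rewrite lte_fin ltr01 -EFinB -EFinM ltry.
- apply: aeW => a n; rewrite /= in_itv/= => /f_le.
  by rewrite gee0_abs.
move: fint; rewrite integral0 => /cvge0P fint.
have [|N _ /(_ N (leqnn _)) /= fN] := fint _ e e0.
  by move=> n; apply: integral_ge0.
exists (N.+1%:R^-1)%R; first by rewrite invr_gt0.
move=> h /andP[h0 hN]; apply: le_lt_trans fN.
apply: (@le_trans _ _ (\int[mu]_(a in `[h, 1%R]) f N a)).
  apply: ge0_le_integral => //.
  - by move=> a _; exact: poweR_ge0.
  - apply: measurable_hausdorff_poweR => //; last exact: decreasing_cut_shift.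
    move=> a b; rewrite /= in_itv/= => /andP[ha _] _.
    by apply: cut_decreasing; exact: le_trans ha.
  - apply: measurable_funS (mf N) => // a; rewrite /= !in_itv/= => /andP[ha ->].
    by rewrite (le_trans h0).
  - move=> a; rewrite /= in_itv/= => /andP[ha a1].
    apply: le_poweR => //; first by apply: hausdorff_ge0; exact: cut0.
    apply: hausdorff_nested => //; first exact: cut0.
      by apply: cut_decreasing; rewrite ?subr_ge0// gerBl.
    by apply: (cut_decreasing (s0 N a)); rewrite ge_max lerB ?subr_ge0// ltW.
apply: ge0_subset_integral; [by []|by []|exact: mf|by move=> a _; exact: poweR_ge0|].
move=> a; rewrite /= !in_itv/= => /andP[ha ->].
by rewrite (le_trans h0).
Qed.

End mean_left_continuity.

(** * Necessity *)

Section necessity.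
Context {R : realType} {m : nat} (p : R) (hp : 1 <= p).
Local Open Scope ereal_scope.
Local Notation mu := (@lebesgue_measure R).
Local Notation K := (2 `^ p)%R.
Implicit Types (u v : fuzzy R m).

Definition shift_pow u (h : R) : \bar R :=
  \int[mu]_(a in `[h, 1%R]) (hausdorff (cut u a) (cut u (a - h)%R) `^ p).

Lemma decreasing_cut_sub u (h : R) : (0 <= h)%R ->
  decreasing_on `[h, 1%R] (cut u).
Proof.
move=> h0 a b; rewrite /= in_itv/= => /andP[ha _] _.
by apply: cut_decreasing; exact: le_trans ha.
Qed.

Lemma integral_hausdorff_sub u v (h : R) : (0 <= h)%R ->
  \int[mu]_(a in `[h, 1%R]) (hausdorff (cut u a) (cut v a) `^ p) <= dp_pow p u v.
Proof.
move=> h0; apply: ge0_subset_integral => //.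
- apply: measurable_hausdorff_poweR => //; exact: decreasing_cut.
- by move=> a _; exact: poweR_ge0.
- by move=> a; rewrite /= !in_itv/= => /andP[ha ->]; rewrite (le_trans h0).
Qed.

Lemma integral_hausdorff_shift u v (h : R) : (0 <= h)%R ->
  \int[mu]_(a in `[h, 1%R])
    (hausdorff (cut u (a - h)%R) (cut v (a - h)%R) `^ p) <= dp_pow p u v.
Proof.
move=> h0; pose f a := hausdorff (cut u a) (cut v a) `^ p.
have mf : measurable_fun (`[0%R, 1%R]%classic : set R) f.
  by apply: measurable_hausdorff_poweR => //; exact: decreasing_cut.
have sub : (`[0%R, (1 - h)%R]%classic : set R) `<=` `[0%R, 1%R].
  move=> a; rewrite /= !in_itv/= => /andP[-> ah]/=.
  by rewrite (le_trans ah)// gerBl.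
have mfh : measurable_fun (`[0%R, (1 - h)%R]%classic : set R) f.
  exact: measurable_funS mf.
have := @ge0_integral_shift R f 0%R (1 - h)%R h mfh.
rewrite add0r subrK => ->; last by move=> a _; exact: poweR_ge0.
apply: ge0_subset_integral; [by []|by []|exact: mf| |exact: sub].
by move=> a _; exact: poweR_ge0.
Qed.

(** The route is from [cut v a] over [cut u a] and [cut u (a - h)] to [cut v (a - h)]. Each of the
    two intermediate stops costs one factor 2 K. *)
Lemma shift_pow_triangle u v (h e : R) : FB u -> FB v -> (0 <= h)%R ->
  dp_pow p v u < e%:E -> shift_pow u h < e%:E ->
  shift_pow v h < (K * (2 * (K * (2 * e))))%:E.
Proof.
move=> uFB vFB h0 vu uh.
have nu : normal_fuzzy u by case: uFB.
have nv : normal_fuzzy v by case: vFB.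
have K0 : (0 < K)%R by rewrite powR_gt0.
have K1 : (1 <= K)%R by rewrite (le_trans _ (le1r_powR _ hp))// ler1n.
have e0 : (0 < e)%R by rewrite -lte_fin; exact: le_lt_trans (dp_pow_ge0 p v u) vu.
have ne w (a : R) : normal_fuzzy w -> (a <= 1)%R -> cut w a !=set0.
  by move=> nw; exact: cut_nonempty.
have step (x y : \bar R) (c : R) : x < c%:E -> y < c%:E ->
    K%:E * (x + y) < (K * (2 * c))%:E.
  move=> xc yc; rewrite EFinM lte_pmul2l ?lte_fin// mulr2n mulrDl mul1r EFinD.
  exact: lteD.
have H : \int[mu]_(a in `[h, 1%R])
    (hausdorff (cut u a) (cut v (a - h)%R) `^ p) < (K * (2 * e))%:E.
  apply: le_lt_trans (step _ _ _ uh (le_lt_trans (integral_hausdorff_shift u v h0) _)).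
    apply: integral_hausdorff_triangle => //.
    - exact: decreasing_cut_sub.
    - exact: decreasing_cut_shift.
    - exact: decreasing_cut_shift.
    - move=> a; rewrite /= in_itv/= => /andP[ha a1].
      have ah1 : (a - h <= 1)%R by rewrite (le_trans _ a1)// gerBl.
      by split; exact: ne.
  rewrite dp_powC; exact: vu.
have vu' : \int[mu]_(a in `[h, 1%R])
    (hausdorff (cut v a) (cut u a) `^ p) < (K * (2 * e))%:E.
  apply: le_lt_trans (integral_hausdorff_sub v u h0) (lt_le_trans vu _).
  rewrite lee_fin -[leLHS]mul1r ler_pM ?(ltW e0)//.
  by rewrite ler_pMl// ler1n.
apply: le_lt_trans (step _ _ _ vu' H).
apply: integral_hausdorff_triangle => //.
- exact: decreasing_cut_sub.
- exact: decreasing_cut_sub.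
- exact: decreasing_cut_shift.
- move=> a; rewrite /= in_itv/= => /andP[ha a1].
  have ah1 : (a - h <= 1)%R by rewrite (le_trans _ a1)// gerBl.
  by split; exact: ne.
Qed.

Lemma cut_origin (a : R) : (0 <= a <= 1)%R ->
  cut (\1_[set 0%R] : fuzzy R m) a = [set 0%R].
Proof.
move=> a01; apply: cut_indic => //; apply: closed_edist => x x0 /=.
apply: enorm_eq0; apply/le_anti; rewrite enorm_ge0 andbT.
apply/ler_addgt0Pr => e e0; have [_ /= -> xe] := x0 e e0.
by rewrite add0r -edistx0 edistC ltW.
Qed.

Lemma dp_pow_origin u (M : R) : FB u -> (forall a, (0 <= a)%R -> cut u a `<=` eball M) ->
  dp_pow p u \1_[set 0%R] <= (M `^ p)%:E.
Proof.
move=> [_ nu _ _] uM; rewrite -[(M `^ p)%R]mulr1 -[X in (_ * X)%R]subr0.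
apply: integral_hausdorff_le => //; try exact: decreasing_cut.
move=> a /andP[a0 a1]; have nua := cut_nonempty nu a1.
rewrite hausdorff_ge0// cut_origin ?a0//; apply: hausdorff_le => x.
  by move=> /(uM _ a0) xM; exists 0%R => //; rewrite edistx0.
move=> /= ->; have [y yu] := nua; exists y => //.
by rewrite edistC edistx0; exact: (uM _ a0).
Qed.

(* Off [eball r] the cut of [v] sticks out of [eball r] at most as far as it
   does out of the smaller cut of [u]. *)
Lemma normp_pow_le u v (r : R) : FB u -> FB v -> (0 <= r)%R -> cut u 0 `<=` eball r ->
  dp_pow p (v \max \1_(@eball R m r)) \1_(@eball R m r) <= dp_pow p v u.
Proof.
move=> uFB vFB r0 ur.
have nu : normal_fuzzy u by case: uFB.
have nv : normal_fuzzy v by case: vFB.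
apply: ge0_le_integral => //.
- by move=> a _; exact: poweR_ge0.
- by apply: measurable_hausdorff_poweR => //; exact: decreasing_cut.
- by apply: measurable_hausdorff_poweR => //; exact: decreasing_cut.
move=> a; rewrite /= in_itv/= => /andP[a0 a1].
have a01 : (0 <= a <= 1)%R by rewrite a0.
rewrite cut_max_indic ?cut_indic//; try exact: closed_eball.
have [x xv] := cut_nonempty nv a1.
have H0 : 0 <= hausdorff (cut v a) (cut u a) by apply: hausdorff_ge0; exists x.
apply: le_poweR => //; first by apply: hausdorff_ge0; exists x; left.
rewrite ge_max; apply/andP; split; last first.
  by apply: le_trans H0; apply: excess_subset => y; right.
apply: ge_ereal_sup => _ [y [yv|yr] <-].
  apply: (@le_trans _ _ (excess (cut v a) (eball r))).
    by apply: ereal_sup_ubound; exists y.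
  apply: le_trans (excess_le_hausdorff _ _); apply: excess_subr.
  by apply: subset_trans ur; exact: cut_decreasing.
apply: le_trans H0; apply: ge_ereal_inf; exists (edist y y)%:E; first by exists y.
by rewrite edistxx.
Qed.

Section relatively_compact.
Context (X U : set (fuzzy R m)) (XFB : X `<=` @FB R m) (UX : U `<=` X).
Context (cU : relatively_compact_in p X U).
Local Notation T := (dp_space p X).

Lemma relatively_compact_cluster (u : nat -> fuzzy R m) : (forall n, U (u n)) ->
  exists2 v, FB v & forall (e : R) N, (0 < e)%R ->
    exists2 n, (N <= n)%N & dp_pow p v (u n) < e%:E.
Proof.
move=> uU; have /choice[w wu] n : exists x : T, val x = u n.
  by exists (exist _ (u n) (mem_set (UX (uU n)))).
have [|x xw] := compact_dp_cluster (u := w) hp XFB cU.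
  by move=> n; apply: subset_closure; rewrite /= wu.
exists (val x); first exact: XFB (set_valP x).
by move=> e N e0; have [n Nn xn] := xw e N e0; exists n; rewrite -?wu.
Qed.

Lemma relatively_compact_mean_bounded : mean_bounded p U.
Proof.
apply: contrapT => H.
have /choice[u uP] (n : nat) : exists u, U u /\ ~ (dp p u \1_[set 0%R] <= n.+1%:R%:E).
  apply: contrapT => Hn; apply: H; exists n.+1%:R => // u Uu.
  by apply: contrapT => Hu; apply: Hn; exists u.
have [v vFB vu] := relatively_compact_cluster (fun n => (uP n).1).
have [M M0 vM] := FB_cut_bounded vFB.
have p0 : (0 < p)%R by rewrite (lt_le_trans _ hp).
(* The summand 1 accounts for the distance from [u n] to [v], and M^p for that from [v] to the
   origin. An index beyond c^(1/p) contradicts the choice of [u n]. *)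
pose c := (K * (1 + M `^ p))%R.
have c0 : (0 <= c)%R by rewrite mulr_ge0 ?addr_ge0 ?powR_ge0.
have [n Nn vun] := vu 1%R (Num.bound (c `^ p^-1)%R) ltr01.
apply: (uP n).2; have uFB : FB (u n) by exact: XFB (UX (uP n).1).
have n0 : normal_fuzzy (\1_[set 0%R] : fuzzy R m).
  by exists 0%R; rewrite indicE mem_set.
apply: (@le_trans _ _ (c%:E `^ p^-1)).
  apply: poweRV_le => //; first exact: dp_pow_ge0.
  have nu : normal_fuzzy (u n) by case: uFB.
  have nv : normal_fuzzy v by case: vFB.
  apply: le_trans (dp_pow_triangle hp nu nv n0) _.
  rewrite EFinM lee_pmul2l ?lte_fin ?powR_gt0// EFinD.
  apply: leeD (dp_pow_origin vFB vM).
  rewrite dp_powC; exact: ltW vun.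
rewrite poweR_EFin lee_fin.
apply: (le_trans (ltW (archi_boundP (powR_ge0 _ _)))).
by rewrite ler_nat leqW.
Qed.

Lemma relatively_compact_equi_left_continuous : mean_equi_left_continuous p U.
Proof.
move=> e e0; apply: contrapT => H.
have K0 : (0 < K)%R by rewrite powR_gt0.
have /choice[uh uP] (n : nat) : exists uh : fuzzy R m * R,
    [/\ U uh.1, (0 <= uh.2 < n.+1%:R^-1)%R & ~ (shift_pow uh.1 uh.2 `^ p^-1 < e%:E)].
  apply: contrapT => Hn; apply: H; exists (n.+1%:R^-1)%R; first by rewrite invr_gt0.
  by move=> h u hn Uu; apply: contrapT => Hu; apply: Hn; exists (u, h).
have uU n : U (uh n).1 by case: (uP n).
have [v vFB vu] := relatively_compact_cluster uU.
(* Inverts the constant of [shift_pow_triangle]; an index beyond 1 / c then brings the shift below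
   [c]. *)
pose d := (e `^ p / (K * 2) / (K * 2))%R.
have d0 : (0 < d)%R by rewrite !divr_gt0 ?mulr_gt0 ?powR_gt0.
have [c c0 vc] := FB_mean_left_continuous hp vFB d0.
have [n Nn vun] := vu d (Num.bound c^-1) d0.
have [_ /andP[h0 hn]] := uP n; apply.
apply/(poweRV_lt hp) => //; first by apply: integral_ge0 => a _; exact: poweR_ge0.
have -> : (e `^ p = K * (2 * (K * (2 * d))))%R by rewrite /d; field; rewrite gt_eqF.
apply: (shift_pow_triangle vFB (XFB (UX (uU n))) h0).
  rewrite dp_powC; exact: vun.
apply: vc; rewrite h0/= (lt_trans hn)// -[ltRHS]invrK ltf_pV2 ?posrE ?invr_gt0//.
by rewrite (lt_le_trans (archi_boundP _))// ?invr_ge0 ?(ltW c0)// ler_nat leqW.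
Qed.

Lemma relatively_compact_normp (u : nat -> fuzzy R m) : (forall n, U (u n)) ->
  exists2 r : R, (0 < r)%R & exists2 phi : nat -> nat,
    {homo phi : i j / (i < j)%N} & normp p r (u (phi n)) @[n --> \oo] --> 0.
Proof.
move=> uU; have [v vFB vu] := relatively_compact_cluster uU.
have [M M0 vM] := FB_cut_bounded vFB.
(* [M] may be 0, whereas the radius has to be positive. *)
have r0 : (0 < M + 1)%R by rewrite ltr_wpDl.
exists (M + 1)%R => //.
have [N k|phi phimon phiP] :=
    @subsequence (fun N n => dp_pow p v (u n) < (N.+1%:R^-1)%:E).
  have [|n] := vu (N.+1%:R^-1)%R k.+1; first by rewrite invr_gt0.
  by exists n.
exists phi => //; apply/cvge0P => [n|e e0]; first exact: poweR_ge0.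
near=> n; apply/(dp_lt hp) => //.
apply: (@le_lt_trans _ _ (dp_pow p (u (phi n)) v)).
  apply: normp_pow_le => //; first exact: XFB (UX (uU _)).
    exact: ltW.
  by move=> x /(vM _ (lexx _)); rewrite /eball/= => /le_trans; apply; rewrite lerDl.
rewrite dp_powC; apply: lt_trans (phiP n) _; rewrite lte_fin.
near: n; have ep0 : (0 < e `^ p)%R by rewrite powR_gt0.
exact: near_infty_natSinv_lt (PosNum ep0).
Unshelve. all: by end_near. Qed.

End relatively_compact.
End necessity.

(** * Selection of a limit *)

Section selection.
Context {R : realType} {m : nat} (p : R) (hp : 1 <= p).
Local Open Scope ereal_scope.
Local Notation mu := (@lebesgue_measure R).
Local Notation ball r := (@eball R m r).

(** A Chebyshev bound: [x] belongs to every cut at a level below [a], so the integrand is at least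
    (|x| - r)^p on all of [0, a]. *)
Lemma dp_pow_eball_ge (u : fuzzy R m) (r a : R) x : (0 < a <= 1)%R ->
  cut u a x -> (r < enorm x)%R ->
  (a * (enorm x - r) `^ p)%:E <= dp_pow p (u \max \1_(ball r)) \1_(ball r).
Proof.
move=> /andP[a0 a1] ux rx; pose c := (enorm x - r)%R.
have mH : measurable_fun (`[0%R, 1%R]%classic : set R) (fun b =>
    hausdorff (cut (u \max \1_(ball r)) b) (cut (\1_(ball r) : fuzzy R m) b) `^ p).
  by apply: measurable_hausdorff_poweR => //; exact: decreasing_cut.
have sub : (`[0%R, a]%classic : set R) `<=` `[0%R, 1%R].
  by move=> b; rewrite /= !in_itv/= => /andP[-> ba]/=; exact: le_trans a1.
apply: (@le_trans _ _ (\int[mu]_(b in `[0%R, a])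
    (hausdorff (cut (u \max \1_(ball r)) b) (cut (\1_(ball r) : fuzzy R m) b) `^ p))).
  apply: (@le_trans _ _ (\int[mu]_(b in `[0%R, a]) cst (c `^ p)%:E b)).
    rewrite integral_cst//= lebesgue_measure_itv/= lte_fin a0.
    by rewrite -EFinB subr0 -EFinM mulrC.
  apply: ge0_le_integral => //.
  - by move=> b _; rewrite lee_fin powR_ge0.
  - exact: measurable_funS mH.
  move=> b /[dup] /sub b01; rewrite /= in_itv/= => /andP[b0 ba].
  rewrite -poweR_EFin; apply: le_poweR => //.
    by rewrite lee_fin subr_ge0 ltW.
  rewrite cut_max_indic ?cut_indic//; try exact: closed_eball.
  apply: le_trans (excess_le_hausdorff _ _).
  apply: (@excess_ge _ _ _ _ _ x); first by left; exact: cut_decreasing ux.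
  by move=> y yr; rewrite lerBlDr (le_trans (enorm_triangle y _))// lerD2l.
apply: ge0_subset_integral; [by []|by []|exact: mH| |exact: sub].
by move=> b _; exact: poweR_ge0.
Qed.

(** Put c = |x| - r. If c <= 1, then c <= 1 / a because a <= 1; otherwise c <= c^p <= 1 / a by the
    preceding bound. *)
Lemma dp_pow_eball_cut (u : fuzzy R m) (r a : R) : (0 < a <= 1)%R ->
  dp_pow p (u \max \1_(ball r)) \1_(ball r) <= 1 -> cut u a `<=` ball (r + a^-1)%R.
Proof.
move=> a01 u1 x ux; rewrite /eball/=; have [|rx] := leP (enorm x) r.
  move=> /le_trans; apply; rewrite lerDl invr_ge0.
  by case/andP: a01 => /ltW.
have := le_trans (dp_pow_eball_ge a01 ux rx) u1.
case/andP: a01 => a0 a1; rewrite lee_fin -ler_pdivlMl// mulr1 => H.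
rewrite addrC -lerBlDr.
have [x1|x1] := leP (enorm x - r)%R 1%R; first by rewrite (le_trans x1)// invf_ge1.
by rewrite (le_trans _ H)// le1r_powR// ltW.
Qed.

(** Rational, so that countably many conditions have to be diagonalized; positive, because the bound
    r + 1 / t on the cuts degenerates at 0. *)
Definition level (t : R) : Prop := (0 < t < 1)%R /\ exists q : rat, t = ratr q.

Lemma level_between (a b : R) : (0 <= a)%R -> (b <= 1)%R -> (a < b)%R ->
  exists2 t, level t & (a < t < b)%R.
Proof.
move=> a0 b1 ab; have [q] := rat_in_itvoo ab; rewrite in_itv/= => /andP[aq qb].
exists (ratr q); last by rewrite aq.
by split; [rewrite (le_lt_trans a0 aq) (lt_le_trans qb)|exists q].
Qed.

Lemma selection (v : nat -> fuzzy R m) (r : R) :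
  (forall n, FB (v n)) -> 
  dp_pow p (v n \max \1_(ball r)) \1_(ball r) @[n --> \oo] --> 0 ->
  exists2 phi : nat -> nat, {homo phi : i j / (i < j)%N} &
  exists2 A : R -> set 'rV[R]_m, (forall t, closed (A t)) &
    forall t (e : R), level t -> (0 < e)%R ->
      \forall n \near \oo, hausdorff (cut (v (phi n)) t) (A t) <= e%:E.
Proof.
move=> vFB /cvge0P v0; have [F [UF ooF]] := @ultraFilterLemma _ \oo _.
pose A t := ulim F (fun n => cut (v n) t).
have FA t (e : R) : level t -> (0 < e)%R ->
    F [set n | hausdorff (cut (v n) t) (A t) <= e%:E].
  move=> [/andP[t0 t1] _] e0; apply: (@hausdorff_ulim _ _ F UF _ (r + t^-1)%R) => //.
  have [|N _ vN] := v0 _ 1%R ltr01; first by move=> n; exact: dp_pow_ge0.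
  apply: ooF; exists N => // n /vN vn1.
  by apply: dp_pow_eball_cut; [rewrite t0 ltW|exact: ltW].
(* The conditions of precision 1 / (k + 1) at level q are numbered by the code of (q, k). Numbers
   that code nothing, or a rational that is no level, impose no condition. *)
pose P j n := if unpickle j is Some (q, k) then level (ratr q) ->
  hausdorff (cut (v n) (ratr q)) (A (ratr q)) <= (k.+1%:R^-1)%:E else True.
have [j|phi phimon phiP] := @subsequence_filter F P _ ooF.
  rewrite /P; case: unpickle => [[q k]|]; last exact: filterE.
  have [lq|nlq] := pselect (level (ratr q)); last by apply: filterE => n /nlq.
  by apply: filterS (FA _ (k.+1%:R^-1)%R lq _) => //; rewrite invr_gt0.
exists phi => //; exists A => [t|t e lt e0]; first exact: closed_ulim.
have [_ [q tq]] := lt; pose k := Num.bound e^-1.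
exists (pickle (q, k)) => // n /= qn; rewrite tq.
have := phiP _ _ qn; rewrite /P pickleK -tq => /(_ lt) /le_trans; apply.
rewrite lee_fin -[leRHS]invrK lef_pV2 ?posrE ?invr_gt0//.
by rewrite (le_trans (ltW (archi_boundP _))) ?ler_nat// invr_ge0 ltW.
Qed.

End selection.

(** * The limit of a sequence whose cuts converge at rational levels *)

Section limit_fuzzy_set.
Context {R : realType} {m : nat} (p : R) (hp : 1 <= p).
Local Notation ball r := (@eball R m r).
Context (w : nat -> fuzzy R m) (r : R) (A : R -> set 'rV[R]_m).
Context (wFB : forall n, FB (w n)).
Context (w0 : forall e : R, 0 < e -> \forall n \near \oo,
  (dp_pow p (w n \max \1_(ball r)) \1_(ball r) < e%:E)%E).
Context (cA : forall t, closed (A t)).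
Context (wA : forall t (e : R), level t -> 0 < e ->
  \forall n \near \oo, (hausdorff (cut (w n) t) (A t) <= e%:E)%E).

(** Adjoining 0 makes [has_sup] true at every point, also at those lying in no [A t]. *)
Definition limit_fuzzy : fuzzy R m :=
  fun x => sup ([set 0] `|` [set t | level t /\ A t x]).
Local Notation winf := limit_fuzzy.

Let nw n : normal_fuzzy (w n). Proof. by have [] := wFB n. Qed.

Let level_gt0 (t : R) : level t -> 0 < t. Proof. by case=> /andP[]. Qed.

Let level_lt1 (t : R) : level t -> t < 1. Proof. by case=> /andP[]. Qed.

(** One half of Kuratowski convergence: points near which the cuts come infinitely often belong to
    the limit. The other half, [limit_set_approx], holds for all late indices, so the two can be
    combined along any subsequence. *)
Lemma limit_set_cluster t y : level t ->
  (forall (e : R) N, 0 < e -> exists2 n, (N <= n)%N &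
    exists2 a, cut (w n) t a & edist a y < e) -> A t y.
Proof.
move=> lt H; apply: (closed_edistP (cA (t := t))) => e e0.
have e30 : 0 < e / 3 by rewrite divr_gt0.
have [N _ NA] := wA lt e30; have [n Nn [a na ay]] := H _ N e30.
have nA : (hausdorff (cut (w n) t) (A t) < (e / 2)%:E)%E.
  by apply: le_lt_trans (NA n Nn) _; rewrite lte_fin; lra.
have [b Ab ab] := hausdorff_lt nA na; exists b => //.
have := edist_triangle a b y; rewrite (edistC b a); lra.
Qed.

Lemma limit_set_approx t y (e : R) : level t -> A t y -> 0 < e ->
  \forall n \near \oo, exists2 a, cut (w n) t a & edist a y < e.
Proof.
move=> lt Ay e0; have e20 : 0 < e / 2 by rewrite divr_gt0.
have [N _ NA] := wA lt e20; exists N => // n /NA nA.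
have nA' : (hausdorff (A t) (cut (w n) t) < e%:E)%E.
  rewrite hausdorffC; apply: le_lt_trans nA _.
  by rewrite lte_fin ltr_pdivrMr// ltr_pMr// ltr1n.
by have [a aw ya] := hausdorff_lt nA' Ay; exists a; rewrite // edistC.
Qed.

Lemma limit_set_decreasing s t : level s -> level t -> s <= t -> A t `<=` A s.
Proof.
move=> ls lt st y Ay; apply: limit_set_cluster => // e N e0.
have [M _ MA] := limit_set_approx lt Ay e0.
exists (maxn N M); first exact: leq_maxl.
have [a aw ay] := MA (maxn N M) (leq_maxr N M); exists a => //.
by apply: cut_decreasing aw => //; exact/ltW/level_gt0.
Qed.

(** A point [y] of [A t] outside the ball is approximated by points of the cuts that stick out by
    more than half as much, namely [s]; each of these contributes at least t s^p to a quantity that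
    tends to 0. *)
Lemma limit_set_eball t : level t -> A t `<=` ball r.
Proof.
move=> lt y Ay; rewrite /eball/= leNgt; apply/negP => ry.
pose s := (enorm y - r) / 2; have s0 : 0 < s by rewrite divr_gt0// subr_gt0.
have t0 := level_gt0 lt.
have ts0 : 0 < t * s `^ p by rewrite mulr_gt0// powR_gt0.
have [N [wN [a aw ay]]] := filter_ex (filterI (w0 ts0) (limit_set_approx lt Ay s0)).
have sa : s < enorm a - r.
  by have := enorm_triangle a y; rewrite edistC; rewrite /s in ay *; lra.
have ra : r < enorm a by rewrite -subr_gt0 (lt_trans s0).
have t01 : 0 < t <= 1 by rewrite t0 ltW// level_lt1.
have := le_lt_trans (dp_pow_eball_ge hp t01 aw ra) wN.
rewrite lte_fin ltr_pM2l// ltNge => /negP; apply.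
have ra0 : 0 <= enorm a - r by exact/ltW/(lt_trans s0).
by apply: ge0_ler_powR; rewrite ?nnegrE;
  [exact: le_trans ler01 hp|exact: ltW s0|exact: ra0|exact: ltW sa].
Qed.

Let S x := [set 0] `|` [set t : R | level t /\ A t x].

Let hsS x : has_sup (S x).
Proof.
split; first by exists 0; left.
by exists 1 => s [->|[/level_lt1/ltW]]; rewrite ?ler01.
Qed.

Lemma limit_fuzzy_ge0 x : 0 <= winf x.
Proof. by apply: ub_le_sup; [exact: (hsS x).2|left]. Qed.

Lemma limit_fuzzy_le1 x : winf x <= 1.
Proof.
apply: ge_sup; first exact: (hsS x).1.
by move=> s [->|[/level_lt1/ltW]]; rewrite ?ler01.
Qed.

Lemma limit_fuzzy_ge t x : level t -> A t x -> t <= winf x.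
Proof. by move=> lt Ax; apply: ub_le_sup; [exact: (hsS x).2|right]. Qed.

Lemma limit_fuzzy_gt t x : level t -> t < winf x -> A t x.
Proof.
move=> lt /(sup_gt (hsS x).1)[s [->|[ls As]] ts].
  by have := lt_trans ts (level_gt0 lt); rewrite ltxx.
exact: limit_set_decreasing (ltW ts) _ As.
Qed.

Lemma limit_fuzzy_lt x (b : R) : winf x < b -> b <= 1 ->
  exists2 t, level t & winf x < t < b /\ ~ A t x.
Proof.
move=> xb b1; have [t lt /andP[xt tb]] := level_between (limit_fuzzy_ge0 x) b1 xb.
exists t => //; rewrite xt tb; split=> // /(limit_fuzzy_ge lt).
by rewrite leNgt xt.
Qed.

Lemma cut_limit_fuzzy (a : R) x : 0 < a <= 1 ->
  cut winf a x <-> forall t, level t -> t < a -> A t x.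
Proof.
move=> /andP[a0 a1]; rewrite cutE//=; split => [ax t lt ta|H].
  exact: limit_fuzzy_gt (lt_le_trans ta ax).
rewrite leNgt; apply/negP => xa.
have [t lt [/andP[_ ta]]] := limit_fuzzy_lt xa a1; apply; exact: H.
Qed.

(** The points are eventually bounded by r + 1 / a, and being of level [a] they are of every lower
    level [t], so their limit lies in each such [A t]. Indices may repeat: only [n <= psi n]
    matters. *)
Lemma limit_fuzzy_cluster (a : R) (psi : nat -> nat) (x : nat -> 'rV[R]_m) :
  0 < a <= 1 -> (forall n, (n <= psi n)%N) -> (forall n, cut (w (psi n)) a (x n)) ->
  exists2 y, cut winf a y &
    forall (e : R) N, 0 < e -> exists2 n, (N <= n)%N & edist (x n) y < e.
Proof.
move=> a01 psin xw; have /andP[a0 a1] := a01.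
have [F [UF ooF]] := @ultraFilterLemma _ \oo _.
have [|y xy] := @ultra_bounded R m F UF x (r + a^-1).
  apply: ooF; have [N _ Nw] := w0 ltr01; exists N => // n /= Nn.
  apply: (dp_pow_eball_cut hp a01) (xw n).
  by apply/ltW/Nw; exact: leq_trans Nn (psin n).
have yc (e : R) N : 0 < e -> exists2 n, (N <= n)%N & edist (x n) y < e.
  move=> e0; have FN : F [set n | (N <= n)%N] by apply: ooF; exists N.
  by have [n [Nn nx]] := filter_ex (filterI FN (xy _ e0)); exists n.
exists y => //; apply/cut_limit_fuzzy => // t lt ta.
apply: limit_set_cluster => // e N e0; have [n Nn xny] := yc e N e0.
exists (psi n); first exact: leq_trans Nn (psin n).
by exists (x n) => //; apply: cut_decreasing (xw n); rewrite ltW// level_gt0.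
Qed.

Lemma cut_limit_fuzzy_eball (a : R) : 0 <= a -> cut winf a `<=` ball r.
Proof.
move=> a0 z /(cut_decreasing (lexx 0) a0).
rewrite /cut eqxx (closure_id (ball r)).1; last exact: closed_eball.
apply: closure_subset => {}z /=.
by move=> /(sup_gt (hsS z).1)[s [->|[ls /(limit_set_eball ls)//]]]; rewrite ltxx.
Qed.

(** Normality comes from a cluster point of points of grade 1. Upper semicontinuity comes from
    closedness of [A t], for a level [t] strictly between the grade and the given bound. *)
Lemma limit_fuzzy_FB : FB winf.
Proof.
split.
- by move=> x; rewrite limit_fuzzy_ge0 limit_fuzzy_le1.
- have /choice[x xP] n := cut_nonempty (nw n) (lexx 1).
  have [||y y1 _] := @limit_fuzzy_cluster 1 id x _ _ xP => //.
    by rewrite ltr01 lexx.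
  exists y; apply/le_anti; rewrite limit_fuzzy_le1/=.
  by move: y1; rewrite cutE.
- move=> x a xa; have [a1|a1] := leP a 1; last first.
    by apply: (@filterE _ (nbhs x)) => y; exact: le_lt_trans (limit_fuzzy_le1 y) a1.
  have [t lt [/andP[_ ta] nAx]] := limit_fuzzy_lt xa a1.
  have nbA : nbhs x (~` A t) by apply: open_nbhs_nbhs; split=> //; exact: closed_openC.
  apply: filterS nbA => y nAy; apply: le_lt_trans ta.
  by rewrite leNgt; apply/negP => /(limit_fuzzy_gt lt)/nAy.
- by exists r; exact: (cut_limit_fuzzy_eball (lexx 0)).
Qed.

(** * Comparison with the limit through a finite grid of levels *)

Lemma unit_grid (k : nat) (a : R) : (0 < k)%N -> k%:R^-1 < a -> a <= 1 ->
  exists2 i, (0 < i < k)%N & a - k%:R^-1 <= i%:R / k%:R < a.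
Proof.
move=> k0 ka a1; have kR0 : 0 < k%:R :> R by rewrite ltr0n.
have ak1 : 1 < a * k%:R by rewrite -ltr_pdivrMr// mul1r.
have akk : a * k%:R <= k%:R by rewrite ger_pMl.
have H : exists i, a * k%:R <= i.+1%:R by exists k; rewrite (le_trans akk)// ler_nat.
(* The least i with a k <= i + 1 satisfies i < a k strictly, which puts [cut winf a] inside the
   limit set at level i / k. It is not 0, since a k > 1. *)
case: (ex_minnP H) => -[|j] Hj jmin; first by move: Hj; rewrite leNgt ak1.
have jak : j.+1%:R < a * k%:R.
  by rewrite ltNge; apply/negP => /jmin; rewrite ltnn.
exists j.+1; first by rewrite -[(j.+1 < k)%N](ltr_nat R) (lt_le_trans jak).
rewrite ltr_pdivrMr// jak andbT ler_pdivlMr// mulrBl mulVf ?gt_eqF//.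
by rewrite lerBlDr natr1.
Qed.

Lemma level_grid (k i : nat) : (0 < i < k)%N -> level (i%:R / k%:R : R).
Proof.
move=> /andP[i0 ik]; have k0 : (0 < k)%N by exact: ltn_trans ik.
split; last by exists (i%:R / k%:R); rewrite fmorph_div/= !ratr_nat.
by rewrite divr_gt0 ?ltr0n//= ltr_pdivrMr ?ltr0n// mul1r ltr_nat.
Qed.

(** The grid has finitely many levels, so that the largest of their thresholds serves all of
    them. *)
Lemma limit_set_grid (k : nat) (e : R) : 0 < e -> \forall n \near \oo,
  forall i, (0 < i < k)%N ->
    (hausdorff (cut (w n) (i%:R / k%:R)) (A (i%:R / k%:R)) <= e%:E)%E.
Proof.
move=> e0; have /choice[N NP] i : exists N, forall n, (N <= n)%N -> (0 < i < k)%N ->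
    (hausdorff (cut (w n) (i%:R / k%:R)) (A (i%:R / k%:R)) <= e%:E)%E.
  have [ik|] := boolP (0 < i < k)%N; last by exists 0%N.
  by have [N _ NA] := wA (level_grid ik) e0; exists N => // n /NA.
exists (\max_(i < k) N i) => // n /= Nn i ik; apply: NP => //.
apply: leq_trans Nn; have /andP[_ ik'] := ik.
exact: (leq_bigmax (Ordinal ik')).
Qed.

Let gap (h : R) n a := hausdorff (cut (w n) a) (cut (w n) (a - h)).

(** A point of [A q] is approximated by points of [cut (w n) q], which lie in [cut (w n) (a - h)].
    For infinitely many n the gap is below [c] and moves them by less than [c] into [cut (w n) a],
    where they cluster at a point of [cut winf a]. *)
Lemma excess_limit_le (q a h c : R) : level q -> 0 <= a - h -> a - h <= q -> q < a ->
  a <= 1 -> 0 < c ->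
  (limn_einf (fun n => gap h n a `^ p) < (c `^ p)%:E)%E ->
  (excess (A q) (cut winf a) <= c%:E)%E.
Proof.
move=> lq ah0 ahq qa a1 c0 gc; apply: excess_le => y Ay.
have a01 : 0 < a <= 1 by rewrite a1 (lt_trans (level_gt0 lq)).
have /choice[f fP] N : exists nz : nat * 'rV[R]_m, [/\ (N <= nz.1)%N,
    cut (w nz.1) a nz.2 & edist y nz.2 < N.+1%:R^-1 + c].
  have N0 : 0 < N.+1%:R^-1 :> R by rewrite invr_gt0.
  have [M _ MA] := limit_set_approx lq Ay N0.
  have [n NMn gn] := limn_einf_lt (maxn N M) gc.
  have [b bq by_] := MA n (leq_trans (leq_maxr _ _) NMn).
  have {}gn : (gap h n a < c%:E)%E.
    by apply: (poweR_lt_EFin hp) gn => //; apply: hausdorff_ge0; exact: cut_nonempty.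
  rewrite /gap hausdorffC in gn.
  have [z za bz] := hausdorff_lt gn (cut_decreasing ah0 ahq bq).
  exists (n, z); split => //=; first exact: leq_trans (leq_maxl _ _) NMn.
  by rewrite (le_lt_trans (edist_triangle b _ _))// ltrD// edistC.
have [||z za zc] := @limit_fuzzy_cluster a (fun n => (f n).1) (fun n => (f n).2) a01.
- by move=> n; case: (fP n).
- by move=> n; case: (fP n).
exists z => //; apply/ler_addgt0Pr => e e0.
have e20 : 0 < e / 2 by rewrite divr_gt0.
have [N _ Ne] := near_infty_natSinv_lt (PosNum e20).
have [n Nn nz] := zc _ N e20; have [_ _ yn] := fP n.
have ne := Ne n Nn; have := edist_triangle (f n).2 y z.
have {}yn : edist y (f n).2 < e / 2 + c by apply: lt_trans yn _; rewrite ltrD2r.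
by rewrite /= in nz; lra.
Qed.

Lemma excess_limit_pow (q a h : R) : level q -> 0 <= a - h -> a - h <= q -> q < a ->
  a <= 1 -> A q !=set0 ->
  (excess (A q) (cut winf a) `^ p <= limn_einf (fun n => gap h n a `^ p))%E.
Proof.
move=> lq ah0 ahq qa a1 Aq0; have p0 : 0 < p by exact: lt_le_trans hp.
have E0 : (0 <= limn_einf (fun n => gap h n a `^ p))%E.
  rewrite leNgt; apply/negP => /(limn_einf_lt 0)[n _].
  by rewrite ltNge poweR_ge0.
case EE : (limn_einf _) E0 => [E| |] // E0; last by rewrite leey.
rewrite lee_fin in E0; apply/lee_addgt0Pr => d d0; rewrite -EFinD.
have Ed0 : 0 < E + d by rewrite ltr_wpDl.
have cE : ((E + d) `^ p^-1) `^ p = E + d.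
  by rewrite -powRrM mulVf ?gt_eqF// powRr1// ltW.
rewrite -cE -poweR_EFin; apply: le_poweR => //; first exact: excess_ge0.
apply: (@excess_limit_le q a h) => //; first exact: powR_gt0.
by rewrite EE cE lte_fin ltrDl.
Qed.

(** The two excesses take different routes through level [q]. From [cut (w n) a] one passes over
    [A q], at the cost of [e] and the liminf; from [cut winf a], a subset of [A q], one passes over
    [cut (w n) q], at the cost of [e] and the gap. *)
Lemma hausdorff_limit_pow n (q a h e : R) : level q -> 0 <= h -> 0 <= a - h ->
  a - h <= q -> q < a -> a <= 1 -> 0 <= e ->
  (hausdorff (cut (w n) q) (A q) <= e%:E ->
  hausdorff (cut (w n) a) (cut winf a) `^ p <=
    (2 `^ p)%:E * ((e `^ p)%:E + (2 `^ p)%:E *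
      (gap h n a `^ p + limn_einf (fun n => gap h n a `^ p))))%E.
Proof.
move=> lq h0 ah0 ahq qa a1 e0 qe; have q0 := level_gt0 lq.
have [_ ninf _ _] := limit_fuzzy_FB.
have wa0 := cut_nonempty (nw n) a1.
have a01 : 0 < a <= 1 by rewrite a1 (lt_trans q0).
have ia0 := cut_nonempty ninf a1.
have iaA : cut winf a `<=` A q.
  by move=> x /(cut_limit_fuzzy _ a01); apply.
have Aq0 : A q !=set0 by case: ia0 => x /iaA; exists x.
have wq0 := cut_nonempty (nw n) (ltW (level_lt1 lq)).
have g0 : (0 <= gap h n a)%E by exact: hausdorff_ge0.
have X0 : (0 <= excess (A q) (cut winf a))%E by exact: excess_ge0.
have wa_wq : cut (w n) a `<=` cut (w n) q by apply: cut_decreasing; exact: ltW.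
have H : (hausdorff (cut (w n) a) (cut winf a) <=
    e%:E + (gap h n a + excess (A q) (cut winf a)))%E.
  rewrite ge_max; apply/andP; split.
    apply: le_trans (excess_triangle _ wa0 Aq0) _; apply: leeD.
      apply: le_trans qe; apply: le_trans (excess_le_hausdorff _ _).
      exact: excess_subl.
    by rewrite leeDr.
  apply: le_trans (excess_triangle _ ia0 wq0) _; apply: leeD.
    apply: le_trans qe; rewrite hausdorffC; apply: le_trans (excess_le_hausdorff _ _).
    exact: excess_subl.
  apply: (@le_trans _ _ (gap h n a)); last by rewrite leeDl.
  rewrite /gap hausdorffC; apply: le_trans (excess_le_hausdorff _ _).
  by apply: excess_subl; exact: cut_decreasing.
apply: le_trans (le_poweR hp (hausdorff_ge0 _ wa0) H) _.
apply: le_trans (poweRD_le hp _ _) _; rewrite ?lee_fin ?adde_ge0//.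
rewrite lee_pmul2l ?lte_fin ?powR_gt0// poweR_EFin leeD2l//.
apply: le_trans (poweRD_le hp _ _) _ => //.
by rewrite lee_pmul2l ?lte_fin ?powR_gt0// leeD2l//; exact: excess_limit_pow.
Qed.

(** Any two points of the cuts are this close: one has norm at most [r], the other at most [r] plus
    the distance to the ball, up to an arbitrarily small [e]. *)
Lemma hausdorff_eball_limit n (a : R) : 0 <= a <= 1 ->
  (hausdorff (cut (w n) a) (cut winf a) <= (2 * r)%:E +
    hausdorff (cut (w n \max \1_(ball r)) a) (cut (\1_(ball r) : fuzzy R m) a))%E.
Proof.
move=> a01; have /andP[a0 a1] := a01.
have [_ ninf _ _] := limit_fuzzy_FB.
have [x xw] := cut_nonempty (nw n) a1; have [y yi] := cut_nonempty ninf a1.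
have ir z : cut winf a z -> enorm z <= r by exact: cut_limit_fuzzy_eball.
rewrite cut_max_indic ?cut_indic//; try exact: closed_eball.
set t := hausdorff _ (ball r).
have t0 : (0 <= t)%E by apply: hausdorff_ge0; exists x; left.
case Et : t t0 => [s| |] // s0; last by rewrite addey ?leey.
rewrite lee_fin in s0; apply/lee_addgt0Pr => e e0; rewrite -!EFinD.
have wr z : cut (w n) a z -> enorm z <= r + s + e.
  move=> zw; have ts : (t < (s + e)%:E)%E by rewrite Et lte_fin ltrDl.
  have [b br zb] := hausdorff_lt ts (or_introl zw).
  by have := enorm_triangle b z; rewrite /eball/= in br; lra.
have wi z z' : cut (w n) a z -> cut winf a z' -> edist z z' <= 2 * r + s + e.
  move=> /wr zw /ir zi; have := edist_triangle 0 z z'.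
  by rewrite edistx0 (edistC 0) edistx0; lra.
apply: hausdorff_le => z zz; first by exists y => //; exact: wi.
by exists x => //; rewrite edistC; exact: wi.
Qed.

Lemma limit_fuzzy_cvg (e : R) : 0 <= r ->
  (forall e : R, 0 < e -> exists2 d, 0 < d &
    forall h n, 0 <= h < d -> (shift_pow p (w n) h < e%:E)%E) ->
  0 < e -> \forall n \near \oo, (dp_pow p (w n) winf < e%:E)%E.
Proof.
move=> r0 wequi e0; pose K : R := 2 `^ p; have p0 : 0 < p by exact: lt_le_trans hp.
have K1 : 1 <= K by rewrite (le_trans _ (le1r_powR _ hp))// ler1n.
have K0 : 0 < K by exact: lt_le_trans K1.
(* The integrals over [0, h] and ]h, 1] add up to at most 3 K q + 2 K^2 q, which is below 8 K^2 q =
   e as K >= 1. *)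
pose q := e / (8 * K * K); have q0 : 0 < q by rewrite divr_gt0// !mulr_gt0.
pose c := q `^ p^-1; have cq : c `^ p = q by rewrite -powRrM mulVf ?gt_eqF// powRr1// ltW.
have [d d0 wd] := wequi q q0.
(* With k > x the mesh h = 1 / k is below [d] by the first summand, and (2 r)^p h <= q by the
   second. *)
pose x := d^-1 + (2 * r) `^ p / q.
have x0 : 0 <= (2 * r) `^ p / q by rewrite divr_ge0 ?powR_ge0// ltW.
have [k k0 xk] : exists2 k : nat, (0 < k)%N & x < k%:R.
  have d10 : 0 < d^-1 by rewrite invr_gt0.
  have xb : 0 <= x by rewrite addr_ge0// ltW.
  exists (Num.bound x); last exact: archi_boundP.
  by rewrite -(ltr_nat R) (le_lt_trans xb) ?archi_boundP.
have kR0 : 0 < k%:R :> R by rewrite ltr0n.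
pose h : R := k%:R^-1; have h0 : 0 < h by rewrite invr_gt0.
have h1 : h <= 1 by rewrite invf_le1// ler1n.
have hd : h < d.
  rewrite -[d]invrK /h ltf_pV2 ?posrE ?invr_gt0//.
  by apply: le_lt_trans xk; rewrite lerDl.
have hr : (2 * r) `^ p * h <= q.
  rewrite /h ler_pdivrMr// (mulrC q) -ler_pdivrMr//; apply/ltW.
  by apply: le_lt_trans xk; rewrite lerDr invr_ge0 ltW.
have [_ ninf _ _] := limit_fuzzy_FB.
near=> n.
have H1 : (dp_pow p (w n \max \1_(ball r)) \1_(ball r) < q%:E)%E.
  by near: n; exact: w0.
have H2 : forall i, (0 < i < k)%N ->
    (hausdorff (cut (w n) (i%:R / k%:R)) (A (i%:R / k%:R)) <= c%:E)%E.
  by near: n; apply: limit_set_grid; rewrite powR_gt0.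
have H01 (a : R) : 0 <= a <= 1 ->
    (0 <= hausdorff (cut (w n) a) (cut winf a))%E.
  by move=> /andP[_ a1]; apply: hausdorff_ge0; exact: cut_nonempty.
have mD (D : set R) (u v : fuzzy R m) : measurable D -> D `<=` `[0, 1] ->
    measurable_fun D (fun a => hausdorff (cut u a) (cut v a)).
  move=> mD D01; apply: (measurable_funS _ D01) => //.
  by apply: measurable_hausdorff => //; exact: decreasing_cut.
have sub1 : `[0, h] `<=` (`[0, 1] : set R).
  by move=> a; rewrite /= !in_itv/= => /andP[-> ah]; exact: le_trans h1.
have sub2 : `]h, 1] `<=` (`[0, 1] : set R).
  by move=> a; rewrite /= !in_itv/= => /andP[/ltW ha ->]; rewrite (le_trans (ltW h0)).
have mpow (D : set R) (f : R -> \bar R) : measurable_fun D f ->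
    measurable_fun D (fun a => f a `^ p)%E.
  by move=> mf; apply: (measurableT_comp (measurable_poweR p)).
have part1 : (\int[lebesgue_measure]_(a in `[0%R, h])
    (hausdorff (cut (w n) a) (cut winf a) `^ p) <= (K * (q + q))%:E)%E.
  pose t a := hausdorff (cut (w n \max \1_(ball r)) a) (cut (\1_(ball r) : fuzzy R m) a).
  apply: le_trans
    (integral_poweRD_le (g := cst (2 * r)%:E) (k := t) hp _ _ _ _ _) _ => //.
  - exact: mD.
  - exact: mD.
  - move=> a /sub1; rewrite /= in_itv/= => a01; split; first exact: H01.
    + by rewrite lee_fin mulr_ge0.
    + apply: hausdorff_ge0; rewrite cut_max_indic//; last exact: closed_eball.
      have [y yw] : cut (w n) a !=set0.
        by apply: cut_nonempty => //; case/andP: a01.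
      by exists y; left.
    + exact: hausdorff_eball_limit.
  rewrite -/K [leRHS]EFinM lee_pmul2l ?lte_fin// EFinD leeD//.
    rewrite (_ : (fun a => _) = cst ((2 * r) `^ p)%:E); last first.
      by [].
    rewrite integral_cst//= lebesgue_measure_itv/= lte_fin h0.
    by rewrite -EFinB subr0 -EFinM lee_fin.
  apply: le_trans (ltW H1); apply: ge0_subset_integral => //.
  - by apply: mpow; exact: mD.
  - by move=> a _; exact: poweR_ge0.
have mgap i : measurable_fun (`]h, 1] : set R) (fun a => gap h i a `^ p)%E.
  apply: (@measurable_funS _ _ _ _ `[h, 1]%classic) => //.
    by move=> a; rewrite /= !in_itv/= => /andP[/ltW -> ->].
  apply: measurable_hausdorff_poweR => //; last exact: decreasing_cut_shift.
  by apply: decreasing_cut_sub; exact: ltW.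
have gapq i : (\int[lebesgue_measure]_(a in `]h, 1%R]) (gap h i a `^ p) <= q%:E)%E.
  apply: (@le_trans _ _ (shift_pow p (w i) h)); last by apply/ltW/wd; rewrite ltW.
  apply: ge0_subset_integral => //.
  - apply: measurable_hausdorff_poweR => //; last exact: decreasing_cut_shift.
    by apply: decreasing_cut_sub; exact: ltW.
  - by move=> a _; exact: poweR_ge0.
  - by move=> a; rewrite /= !in_itv/= => /andP[/ltW -> ->].
pose L a := limn_einf (fun i => gap h i a `^ p)%E.
have mL : measurable_fun (`]h, 1] : set R) L by exact: measurable_fun_limn_einf.
have L0 a : (0 <= L a)%E.
  rewrite leNgt; apply/negP => /(limn_einf_lt 0)[i _].
  by rewrite ltNge poweR_ge0.
have Lq : (\int[lebesgue_measure]_(a in `]h, 1%R]) L a <= q%:E)%E.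
  apply: le_trans (fatou _ _ _ _) _ => //.
    by move=> i a _; exact: poweR_ge0.
  by apply: limn_einf_le; exact: nearW.
have part2 : (\int[lebesgue_measure]_(a in `]h, 1%R])
    (hausdorff (cut (w n) a) (cut winf a) `^ p) <= (K * (q + K * (q + q)))%:E)%E.
  apply: (@le_trans _ _ (\int[lebesgue_measure]_(a in `]h, 1%R])
      (K%:E * (cst q%:E a + K%:E * (gap h n a `^ p + L a))))%E).
    apply: ge0_le_integral => //.
    - by move=> a _; exact: poweR_ge0.
    - by apply: mpow; exact: mD.
    - apply: measurable_funeM; apply: emeasurable_funD => //.
      apply: measurable_funeM; apply: emeasurable_funD; [exact: mgap|exact: mL].
    - move=> a; rewrite /= in_itv/= => /andP[ha a1].
      have [i ik /andP[ai ia]] := unit_grid k0 ha a1.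
      rewrite -cq; apply: (hausdorff_limit_pow (level_grid ik)) => //.
      + exact: ltW.
      + by rewrite subr_ge0 ltW.
      + exact: powR_ge0.
      + exact: H2.
  have gL0 a : (0 <= gap h n a `^ p + L a)%E by rewrite adde_ge0 ?poweR_ge0.
  have mgL : measurable_fun (`]h, 1] : set R) (fun a => gap h n a `^ p + L a)%E.
    by apply: emeasurable_funD; [exact: mgap|exact: mL].
  have mKgL := measurable_funeM K%:E mgL.
  have KgL0 a : (0 <= K%:E * (gap h n a `^ p + L a))%E.
    by apply: mule_ge0 => //; rewrite lee_fin ltW.
  rewrite ge0_integralZl ?lee_fin ?(ltW K0)//; last 2 first.
  - by apply: emeasurable_funD; [exact: measurable_cst|exact: mKgL].
  - by move=> a _; rewrite adde_ge0// lee_fin ltW.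
  rewrite [leRHS]EFinM lee_pmul2l ?lte_fin// ge0_integralD//; last first.
    by move=> a _; rewrite lee_fin ltW.
  rewrite [leRHS]EFinD leeD//.
    rewrite integral_cst//= lebesgue_measure_itv/=; case: ifPn => _; last first.
      by rewrite mule0 lee_fin ltW.
    by rewrite -EFinB -EFinM lee_fin ger_pMr// gerBl ltW.
  rewrite ge0_integralZl ?lee_fin ?(ltW K0)// [leRHS]EFinM lee_pmul2l ?lte_fin//.
  rewrite ge0_integralD//; [|by move=> a _; exact: poweR_ge0|exact: mgap].
  rewrite [leRHS]EFinD; exact: leeD (gapq n) Lq.
rewrite /dp_pow (@itv_bndbnd_setU _ _ _ (BRight h)) ?bnd_simp ?(ltW h0)//.
rewrite ge0_integral_setU//.
- apply: le_lt_trans (leeD part1 part2) _; rewrite -EFinD lte_fin.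
  have -> : e = K * K * (8 * q) by rewrite /q; field; rewrite gt_eqF.
  have Kq : q <= K * q by rewrite ler_pMl.
  have KKq : K * q <= K * (K * q) by rewrite ler_wpM2l// ltW.
  have KKq0 : 0 < K * (K * q) by rewrite mulr_gt0// mulr_gt0.
  have -> : K * (q + q) + K * (q + K * (q + q)) = 3 * (K * q) + 2 * (K * (K * q)).
    by ring.
  have -> : K * K * (8 * q) = 8 * (K * (K * q)) by ring.
  by lra.
- rewrite -itv_bndbnd_setU ?bnd_simp ?(ltW h0)//.
  by apply: mpow; exact: mD.
- by move=> a _; exact: poweR_ge0.
- apply/disj_setPS => a []; rewrite /= !in_itv/= => /andP[_ ah] /andP[ha _].
  by have := le_lt_trans ah ha; rewrite ltxx.
Unshelve. all: by end_near. Qed.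

(** * Stability of the four classes under the limit *)

Lemma limit_set_convex t (l : R) y z : level t -> 0 <= l <= 1 ->
  (forall (e : R) N, 0 < e -> exists2 n, (N <= n)%N & exists a b,
    [/\ edist a y < e, edist b z < e & cut (w n) t (l *: a + (1 - l) *: b)]) ->
  A t (l *: y + (1 - l) *: z).
Proof.
move=> lt l01 H; have /andP[l0 l1] := l01.
apply: limit_set_cluster => // e N e0; have e20 : 0 < e / 2 by rewrite divr_gt0.
have [n Nn [a [b [ay bz ab]]]] := H _ N e20.
exists n => //; exists (l *: a + (1 - l) *: b) => //.
apply: le_lt_trans (edist_convex _ _ _ _ l01) _.
apply: (@le_lt_trans _ _ (l * (e / 2) + (1 - l) * (e / 2))).
  by rewrite lerD// ler_wpM2l ?subr_ge0// ltW.
by rewrite -mulrDl subrKC mul1r ltr_pdivrMr// ltr_pMr// ltr1n.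
Qed.

(** If the inequality failed, some level [t] would separate its two sides: [A t] would contain both
    points but not their combination. *)
Lemma limit_fuzzy_E : (forall n, fuzzy_E (w n)) -> fuzzy_E winf.
Proof.
move=> wE; split=> [|x y l l01]; first exact: limit_fuzzy_FB.
rewrite leNgt; apply/negP => xy.
have m1 : Num.min (winf x) (winf y) <= 1 by rewrite ge_min limit_fuzzy_le1.
have [t lt [/andP[_ tm]]] := limit_fuzzy_lt xy m1; apply.
move: tm; rewrite lt_min => /andP[/(limit_fuzzy_gt lt) tx /(limit_fuzzy_gt lt) ty].
have t0 := level_gt0 lt.
apply: limit_set_convex => // e N e0.
have [M1 _ H1] := limit_set_approx lt tx e0.
have [M2 _ H2] := limit_set_approx lt ty e0.
pose n := maxn N (maxn M1 M2); exists n; first exact: leq_maxl.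
have [|a aw ax] := H1 n; first by rewrite /= /n !leq_max leqnn !orbT.
have [|b bw by_] := H2 n; first by rewrite /= /n !leq_max leqnn !orbT.
exists a, b; split=> //; move: aw bw; rewrite !cutE//= => aw bw.
by apply: le_trans ((wE n).2 a b l l01); rewrite le_min aw.
Qed.

(** The centers need only cluster at [z], because points of [A t] are approximated at all late
    indices, in particular where [c n] is near [z]. *)
Lemma limit_fuzzy_star (c : nat -> 'rV[R]_m) z :
  (forall (e : R) N, 0 < e -> exists2 n, (N <= n)%N & edist (c n) z < e) ->
  (forall n y l, 0 <= l <= 1 -> w n y <= w n (l *: y + (1 - l) *: c n)) ->
  forall y l, 0 <= l <= 1 -> winf y <= winf (l *: y + (1 - l) *: z).
Proof.
move=> cz wc y l l01; rewrite leNgt; apply/negP => yz.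
have [t lt [/andP[_ /(limit_fuzzy_gt lt) ty]]] := limit_fuzzy_lt yz (limit_fuzzy_le1 _).
apply; have t0 := level_gt0 lt; apply: limit_set_convex => // e N e0.
have [M _ H] := limit_set_approx lt ty e0.
have [n NMn cn] := cz _ (maxn N M) e0.
exists n; first exact: leq_trans (leq_maxl _ _) NMn.
have [a aw ay] := H n (leq_trans (leq_maxr _ _) NMn).
exists a, (c n); split=> //; move: aw; rewrite !cutE//= => aw.
exact: le_trans aw (wc n a l l01).
Qed.

Lemma limit_fuzzy_S0 : (forall n, fuzzy_S0 (w n)) -> fuzzy_S0 winf.
Proof.
move=> wS; split=> [|y l l01]; first exact: limit_fuzzy_FB.
have := @limit_fuzzy_star (fun=> 0) 0 _ _ y l l01.
rewrite scaler0 addr0; apply.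
  by move=> e N e0; exists N => //; rewrite edistxx.
by move=> n x k k01; rewrite scaler0 addr0; exact: (wS n).2.
Qed.

Lemma limit_fuzzy_S : (forall n, fuzzy_S (w n)) -> fuzzy_S winf.
Proof.
move=> wS; split; first exact: limit_fuzzy_FB.
have /choice[c cP] n := (wS n).2.
(* The star inequality with [l = 0] at a point of grade 1 gives the center grade 1; the centers thus
   lie in the cuts at level 1, which is what makes them cluster. *)
have c1 n : cut (w n) 1 (c n).
  have [x wx] := nw n; have := cP n x 0; rewrite scale0r add0r subr0 scale1r wx.
  by rewrite cutE//=; apply; rewrite lexx ler01.
have [||z _ cz] := @limit_fuzzy_cluster 1 id c _ _ c1 => //.
  by rewrite ltr01 lexx.
by exists z; exact: limit_fuzzy_star cz cP.
Qed.

Lemma limit_set_star t : (forall n, fuzzy_St (w n)) -> level t ->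
  exists2 c, A t c & forall y l, A t y -> 0 <= l <= 1 -> A t (l *: c + (1 - l) *: y).
Proof.
move=> wS lt; have t0 := level_gt0 lt.
have /choice[c cP] n : exists c, cut (w n) t c /\
    forall y, cut (w n) t y -> segment c y `<=` cut (w n) t.
  have [|c cw cy] := (wS n).2 t; first by rewrite t0 ltW// level_lt1.
  by exists c.
have [||z _ cz] := @limit_fuzzy_cluster t id c _ _ (fun n => (cP n).1) => //.
  by rewrite t0 ltW// level_lt1.
exists z.
  apply: limit_set_cluster => // e N e0; have [n Nn ncz] := cz e N e0.
  by exists n => //; exists (c n) => //; exact: (cP n).1.
move=> y l ty l01; apply: limit_set_convex => // e N e0.
have [M _ H] := limit_set_approx lt ty e0.
have [n NMn cn] := cz _ (maxn N M) e0.
exists n; first exact: leq_trans (leq_maxl _ _) NMn.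
have [a aw ay] := H n (leq_trans (leq_maxr _ _) NMn).
exists (c n), a; split=> //.
by apply: ((cP n).2 a aw); exists l.
Qed.

(* A star center of the cut at level [a] is a cluster point of star centers
   of [A t] as [t] increases to [a]. *)
Lemma limit_fuzzy_St : (forall n, fuzzy_St (w n)) -> fuzzy_St winf.
Proof.
move=> wS; split=> [|a a01]; first exact: limit_fuzzy_FB.
have /andP[a0 a1] := a01.
have /choice[f fP] (j : nat) : exists tc : R * 'rV[R]_m,
    [/\ level tc.1, a - j.+1%:R^-1 < tc.1, tc.1 < a, A tc.1 tc.2 &
      forall y l, A tc.1 y -> 0 <= l <= 1 -> A tc.1 (l *: tc.2 + (1 - l) *: y)].
  have [||t lt /andP[at_ ta]] := @level_between R (Num.max (a - j.+1%:R^-1) 0) a _ a1.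
  - by rewrite le_max lexx orbT.
  - by rewrite gt_max a0 andbT gtrBl invr_gt0.
  have [c tc cs] := limit_set_star wS lt; exists (t, c); split => //=.
  by apply: le_lt_trans at_; rewrite le_max lexx.
have [n|z fz] := @bounded_cluster R m (fun j => (f j).2) r.
  by have [lt _ _ /(limit_set_eball lt)] := fP n.
have near_level s (e : R) : level s -> s < a -> 0 < e ->
    exists2 j, s <= (f j).1 & edist (f j).2 z < e.
  move=> ls sa e0; have as0 : 0 < a - s by rewrite subr_gt0.
  have [N _ Ns] := near_infty_natSinv_lt (PosNum as0).
  have [j Nj jz] := fz e N e0; exists j => //; have := Ns j Nj => /=.
  have [_ aj _ _ _] := fP j; rewrite ltrBrDl -ltrBrDr => sj.
  exact/ltW/(lt_trans sj).
exists z.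
  apply/cut_limit_fuzzy => // s ls sa; apply: (closed_edistP (cA (t := s))) => e e0.
  have [j sj jz] := near_level s e ls sa e0; exists (f j).2 => //.
  by have [lj _ _ Aj _] := fP j; exact: limit_set_decreasing Aj.
move=> y /(cut_limit_fuzzy _ a01) yA _ [l /= l01 <-].
apply/cut_limit_fuzzy => // s ls sa; apply: (closed_edistP (cA (t := s))) => e e0.
have [j sj jz] := near_level s e ls sa e0; have [lj _ ja _ sj'] := fP j.
exists (l *: (f j).2 + (1 - l) *: y).
  by apply: (limit_set_decreasing ls lj sj); apply: sj' => //; exact: yA.
apply: le_lt_trans (edist_convex _ _ _ _ l01) _.
rewrite edistxx mulr0 addr0; have /andP[l0 l1] := l01.
by apply: le_lt_trans jz; rewrite ler_piMl// edist_ge0.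
Qed.

End limit_fuzzy_set.

(** * Sufficiency *)

Section sufficiency.
Context {R : realType} {m : nat} (p : R) (hp : 1 <= p).
Context (X U : set (fuzzy R m)).
Context (hX : [\/ X = @fuzzy_St R m, X = @fuzzy_E R m, X = @fuzzy_S0 R m
               | X = @fuzzy_S R m]).
Context (UX : U `<=` X).
Local Notation T := (dp_space p X).

Lemma class_sub_FB : X `<=` @FB R m.
Proof. by case: hX => -> u []. Qed.

Let leq_homo (phi : nat -> nat) n : {homo phi : i j / (i < j)%N} -> (n <= phi n)%N.
Proof.
move=> phimon; elim: n => // n IH.
exact: leq_ltn_trans IH (phimon _ _ (ltnSn n)).
Qed.

Lemma sequence_dp_cluster (u : nat -> fuzzy R m) :
  mean_equi_left_continuous p U -> (forall n, U (u n)) ->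
  (exists2 r : R, 0 < r & exists2 phi : nat -> nat,
    {homo phi : i j / (i < j)%N} & normp p r (u (phi n)) @[n --> \oo] --> 0%E) ->
  exists2 v, X v & forall (e : R) N, 0 < e -> exists2 n, (N <= n)%N &
    (dp_pow p v (u n) < e%:E)%E.
Proof.
move=> Uequi uU [r r0 [phi phimon ucvg]].
have uFB n : FB (u n) by exact: class_sub_FB (UX (uU n)).
have normp_ge0 n : (0 <= normp p r (u (phi n)))%E by exact: poweR_ge0.
have ucvg' : dp_pow p (u (phi n) \max \1_(@eball R m r)) \1_(@eball R m r)
    @[n --> \oo] --> 0%E.
  apply/cvge0P => [n|e e0]; first exact: dp_pow_ge0.
  have ep0 : 0 < e `^ p^-1 by rewrite powR_gt0.
  have [N _ H] := (cvge0P normp_ge0).1 ucvg _ ep0.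
  by exists N => // n /H /(dp_lt_powRV hp _ _ e0).
have [psi psimon [A cA wA]] := selection hp (fun n => uFB (phi n)) ucvg'.
pose w n := u (phi (psi n)).
have wFB n : FB (w n) by exact: uFB.
have w0 (e : R) : 0 < e -> \forall n \near \oo,
    (dp_pow p (w n \max \1_(@eball R m r)) \1_(@eball R m r) < e%:E)%E.
  move=> e0; have [|N _ H] := (cvge0P _).1 ucvg' _ e0.
    by move=> n; exact: dp_pow_ge0.
  exists N; first by [].
  move=> n /= Nn; exact: H (psi n) (leq_trans Nn (leq_homo _ psimon)).
have wequi (e : R) : 0 < e -> exists2 d, 0 < d &
    forall h n, 0 <= h < d -> (shift_pow p (w n) h < e%:E)%E.
  move=> e0; have ep0 : 0 < e `^ p^-1 by rewrite powR_gt0.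
  have [d d0 dU] := Uequi _ ep0; exists d => // h n hd.
  have := dU h (w n) hd (uU _); rewrite (poweRV_lt hp)//.
    by rewrite -powRrM mulVf ?powRr1 ?ltW// gt_eqF// (lt_le_trans _ hp).
  by apply: integral_ge0 => a _; exact: poweR_ge0.
exists (limit_fuzzy A).
  have wX n : X (w n) by exact/UX/uU.
  case: hX => XE; rewrite XE in wX *.
  - exact: (limit_fuzzy_St hp wFB w0 cA wA).
  - exact: (limit_fuzzy_E hp wFB w0 cA wA).
  - exact: (limit_fuzzy_S0 hp wFB w0 cA wA).
  - exact: (limit_fuzzy_S hp wFB w0 cA wA).
move=> e N e0.
have [M _ H] := limit_fuzzy_cvg hp wFB w0 cA wA (ltW r0) wequi e0.
exists (phi (psi (maxn N M))); last first.
  by rewrite dp_powC; apply: H; exact: leq_maxr.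
apply: leq_trans (leq_homo _ phimon).
exact: leq_trans (leq_maxl _ _) (leq_homo _ psimon).
Qed.

Lemma relatively_compact_suff : mean_equi_left_continuous p U ->
  (forall u : nat -> fuzzy R m, (forall n, U (u n)) ->
    exists2 r : R, 0 < r & exists2 phi : nat -> nat,
      {homo phi : i j / (i < j)%N} & normp p r (u (phi n)) @[n --> \oo] --> 0%E) ->
  relatively_compact_in p X U.
Proof.
move=> Uequi Unorm; apply: (sequentially_compact_dp hp class_sub_FB) => u uU.
have [v Xv vu] := sequence_dp_cluster Uequi uU (Unorm _ uU).
by exists (exist _ v (mem_set Xv)).
Qed.

End sufficiency.

Theorem theorem6p17 (R : realType) (m : nat) (p : R) (X U : set (fuzzy R m))
    (hm : (1 <= m)%N) (hp : 1 <= p)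
    (hX : [\/ X = @fuzzy_St R m, X = @fuzzy_E R m, X = @fuzzy_S0 R m
            | X = @fuzzy_S R m])
    (hU : U `<=` X) :
  relatively_compact_in p X U <->
  [/\ mean_bounded p U,
      mean_equi_left_continuous p U &
      forall u : nat -> fuzzy R m, (forall n, U (u n)) ->
        exists2 r : R, 0 < r &
        exists2 phi : nat -> nat, {homo phi : i j / (i < j)%N} &
          normp p r (u (phi n)) @[n --> \oo] --> 0%E].
Proof.
have XFB := class_sub_FB hX.
split=> [cU|[_ Uequi Unorm]]; last first.
  exact: (relatively_compact_suff hp hX hU Uequi Unorm).
split.
- exact: (relatively_compact_mean_bounded hp XFB hU cU).
- exact: (relatively_compact_equi_left_continuous hp XFB hU cU).
- by move=> u uU; exact: (relatively_compact_normp hp XFB hU cU uU).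
Qed.
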